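(* Assume that $E$ is separable and that for all $t>0$ the operator $Q_t$ is the covariance operator of a centred Gaussian Borel measure $\mu_t$ on $E$. If $S$ restricts to a $C_0$-semigroup on $H$, then the following assertions are equivalent: (1) $P$ has the strong Feller property; (2) $S(t)E\subseteq H$ for all $t>0$.
   Context: $E$ is a real Banach space with dual $E^*$; $S=\{S(t)\}_{t\ge0}$ is a $C_0$-semigroup of bounded linear operators on $E$ with adjoint operators $S^*(t)$ on $E^*$. $H$ is a real Hilbert space with a continuous injective linear map $i:H\to E$; $H$ is identified with its image in $E$, and $Q:=i\circ i^*\in\mathcal L(E^*,E)$ ($H$ being identified with its dual). For $t>0$, $Q_t x^*:=\int_0^t S(s)QS^*(s)x^*\,ds$ for $x^*\in E^*$. ''$S$ restricts to a $C_0$-semigroup on $H$'' means that $S(t)H\subseteq H$ for all $t\ge0$ and the restricted operators form a $C_0$-semigroup on the Hilbert space $H$. The Ornstein-Uhlenbeck semigroup $P=\{P(t)\}_{t\ge0}$ on the space $B_b(E)$ of bounded Borel functions on $E$ is $P(t)f(x)=\int_E f(S(t)x+y)\,d\mu_t(y)$ ($\mu_0=\delta_0$). $P$ has the strong Feller property if for every $t>0$, $P(t)$ maps $B_b(E)$ into $C_b(E)$, the space of bounded continuous functions on $E$. *)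

(* Defs.v *)
From mathcomp Require Export all_boot all_order all_algebra.
From mathcomp Require Export all_classical all_reals all_analysis.

Set Implicit Arguments.
Unset Strict Implicit.
Unset Printing Implicit Defensive.

Export Order.TTheory GRing.Theory Num.Theory numFieldNormedType.Exports.
Global Open Scope classical_set_scope.
Global Open Scope ring_scope.

Section bochner.
Context {d : measure_display} {T : measurableType d} {R : realType}
  {E : normedModType R}.
Variables (m : {measure set T -> \bar R}) (D : set T).

Definition bochner_simple (g : T -> E) : Prop :=
  [/\ finite_set (g @` D),
      forall y, measurable (D `&` g @^-1` [set y]) &
      forall y, y != 0 -> (m (D `&` g @^-1` [set y]) < +oo)%E].

(* On the level set over [y = 0], whose measure may be infinite, the summand
   vanishes. *)
Definition bochner_simple_integral (g : T -> E) : E :=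
  \sum_(y \in g @` D) fine (m (D `&` g @^-1` [set y])) *: y.

(* [f] is Bochner integrable over [D], with integral [v].  The almost
   everywhere convergence (strong measurability) is required explicitly because
   [\int] of a nonnegative function is only a lower integral when the function
   is not measurable. *)
Definition is_bochner_integral (f : T -> E) (v : E) : Prop :=
  exists g : nat -> T -> E,
    [/\ forall n, bochner_simple (g n),
        {ae m, forall x, D x -> g n x @[n --> \oo] --> f x},
        (\int[m]_(x in D) (`|f x - g n x|)%:E)%E @[n --> \oo] --> (0 : \bar R) &
        bochner_simple_integral (g n) @[n --> \oo] --> v].

Definition bochner_integral (f : T -> E) : E := get (is_bochner_integral f).

End bochner.

Section semigroups.
Context {R : realType}.

(* Only the values [T t] with [0 <= t] are meaningful. *)
Record C0_semigroup (V : normedModType R) (T : R -> {linear V -> V}) : Prop := {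
  C0_bounded : forall t, 0 <= t -> continuous (T t);
  C0_at0 : forall x, T 0 x = x;
  C0_add : forall s t x, 0 <= s -> 0 <= t -> T (s + t) x = T s (T t x);
  C0_strongly_continuous : forall x, T t x @[t --> 0^'+] --> x }.

(* As [i] is injective, [SH] is the restriction of [S] to the image of [i],
   transported to [H]; its existence includes the invariance of that image. *)
Definition restricts_to_C0_semigroup (E H : normedModType R)
    (i : {linear H -> E}) (S : R -> {linear E -> E}) : Prop :=
  exists SH : R -> {linear H -> H},
    C0_semigroup SH /\ forall t h, 0 <= t -> i (SH t h) = S t (i h).

End semigroups.

(* The inner product [ip] induces the norm of [H]; together with completeness
   this makes [H] a real Hilbert space. *)
Definition induces_norm (R : realType) (H : normedModType R)
    (ip : {dot H for idfun}) : Prop :=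
  forall h : H, ip h h = `|h| ^+ 2.

Definition separable (T : topologicalType) : Prop :=
  exists2 A : set T, countable A & dense A.

Section covariance.
Context {R : realType} {E H : completeNormedModType R}.
Variables (ip : {dot H for idfun}) (i : {linear H -> E})
  (S : R -> {linear E -> E}).

(* Elements of the dual of [E] are the continuous [phi : {linear E -> R^o}];
   [phi \o S t] is the adjoint of [S t] applied to [phi].  [istar] is the
   adjoint of [i], with [H] identified with its dual: the representing vector
   exists and is unique by the Riesz theorem. *)
Definition istar (phi : E -> R) : H :=
  get [set h : H | forall g : H, ip h g = phi (i g)].

Definition Qop (phi : E -> R) : E := i (istar phi).

Definition Qt (t : R) (phi : E -> R) : E :=
  bochner_integral (@lebesgue_measure R) `[0, t]
    (fun s => S s (Qop (phi \o S s))).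

End covariance.

Definition borel_type (T : ptopologicalType) := g_sigma_algebraType (@open T).

Section gaussian.
Context {R : realType} {E : completeNormedModType R}.

(* Degenerate laws are included; [normal_prob 0 0] is not the Dirac mass. *)
Definition centred_gaussian_law
    (nu : set (measurableTypeR R) -> \bar R) : Prop :=
  (forall A, measurable A -> nu A = \d_(0 : R) A) \/
  exists2 sigma : R, 0 < sigma &
    forall A, measurable A -> nu A = normal_prob 0 sigma A.

Definition centred_gaussian (mu : probability (borel_type E) R) : Prop :=
  forall phi : {linear E -> R^o}, continuous phi ->
    centred_gaussian_law (pushforward mu phi).

Definition is_covariance_operator (C : (E -> R) -> E)
    (mu : probability (borel_type E) R) : Prop :=
  forall phi psi : {linear E -> R^o}, continuous phi -> continuous psi ->
    psi (C phi) = (\int[mu]_x (phi x * psi x))%R.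

Definition ornstein_uhlenbeck (S : R -> {linear E -> E})
    (mu : R -> probability (borel_type E) R) (t : R) (f : E -> R) (x : E) : R :=
  (\int[mu t]_y f (S t x + y))%R.

Definition strong_feller (P : R -> (E -> R) -> E -> R) : Prop :=
  forall t : R, 0 < t -> forall f : E -> R,
    measurable_fun [set: borel_type E] (f : borel_type E -> R) ->
    bounded_fun f ->
    continuous (P t f) /\ bounded_fun (P t f).

End gaussian.

(* Main.v *)
Require Import Defs.
From HB Require Import structures.
From mathcomp Require Import ring lra measurable_realfun.

(** For a functional phi, the variance of phi under mu t is the energy
    int_0^t |istar (phi o S s)|^2 ds, by cov_energy. Write sd_t(phi) for its
    square root. Both assertions are equivalent to the following condition on
    the Cameron-Martin space of mu t: for all t > 0 and x there is C such that
    |phi (S t x)| <= C sd_t(phi) for every phi in the dual of E.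

    The strong Feller property implies the condition
    (cameron_martin_of_continuity). If no C exists, there are functionals phi_n
    with phi_n (S t x) = n and summable variances. The set A of the points y with
    |phi_n (y)| < 1 for all large n has full measure, but no point of A remains
    in A after a translation by e (S t x) with e > 0. So P t applied to the
    indicator of A takes the value 1 at 0 and 0 at x / (n + 1) for all n.

    The condition implies the strong Feller property. By uniform boundedness C
    can be taken of the form C' |x| (cameron_martin_uniform), and a translation by
    a vector h with |phi h| <= e sd_t(phi) for all phi changes the integral of a
    Borel function bounded by M by at most 2 M e (gaussian_shift); hence P t f is
    Lipschitz. That estimate is proved first for trigonometric polynomials p, where
    it rests on the characteristic functions of single functionals only: the
    derivative of the mean of p (y + r h) with respect to r is the mean of
    psi (y) p (y + r h), where psi is a functional that nearly represents h for the
    covariance form. It passes to Borel functions because each Borel function with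
    values in [0, 1] is a limit in L1 of trigonometric polynomials with values in
    [0, 1] (trig_approx_measurable).

    The restriction SH of S to H links the condition to the image of H. As
    istar (phi o S s) is the image of istar phi under the adjoint of SH s, the
    condition yields |phi (S t x)| <= C |istar phi|, and the Riesz theorem provides
    h with i h = S t x (range_of_bound). Conversely, if S (t / 2) x = i k, then for
    s <= t / 2 the number phi (S t x) is the inner product of istar (phi o S s) with
    SH (t / 2 - s) k; squaring and integrating over s gives the condition
    (bound_of_range).

    The operator Qt is defined by a Bochner integral, so the formula for the
    variance also requires that this integral exists (bochner_integral_exists,
    dual_Qt). *)

Set Implicit Arguments.
Unset Strict Implicit.
Unset Printing Implicit Defensive.

(** * Continuous linear functionals *)

Section dual_space.
Context {R : realType} {E : normedModType R}.
Implicit Types (phi psi : E -> R) (x y : E).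

(** The dual space, as a predicate on plain functions: linear combinations and
    compositions with operators can then be written as they stand. The bound is
    equivalent to continuity. *)
Definition dual phi : Prop :=
  (forall a x y, phi (a *: x + y) = a * phi x + phi y) /\
  exists C, forall x, `|phi x| <= C * `|x|.

Lemma dual0 phi : dual phi -> phi 0 = 0.
Proof. by move=> -[/(_ (-1) 0 0) + _]; rewrite scaler0 addr0 => ->; ring. Qed.

Lemma dualD phi x y : dual phi -> phi (x + y) = phi x + phi y.
Proof. by move=> -[/(_ 1 x y) + _]; rewrite scale1r mul1r. Qed.

Lemma dualZ phi a x : dual phi -> phi (a *: x) = a * phi x.
Proof. by move=> dphi; have := dphi.1 a x 0; rewrite addr0 dual0// addr0. Qed.

Lemma dualN phi x : dual phi -> phi (- x) = - phi x.
Proof. by move=> dphi; rewrite -scaleN1r dualZ// mulN1r. Qed.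

Lemma dualB phi x y : dual phi -> phi (x - y) = phi x - phi y.
Proof. by move=> dphi; rewrite dualD// dualN. Qed.

Lemma dual_bound phi : dual phi ->
  exists2 C, 0 <= C & forall x, `|phi x| <= C * `|x|.
Proof.
move=> -[_ [C phiC]]; exists `|C| => // x.
by rewrite (le_trans (phiC x))// ler_wpM2r// ler_norm.
Qed.

Lemma dual_continuous phi : dual phi -> continuous (phi : E -> R^o).
Proof.
move=> dphi x; have [C C0 phiC] := dual_bound dphi.
apply/cvgrPdist_lt => e e0; near=> y.
rewrite -dualB// (le_lt_trans (phiC _))//.
rewrite (@le_lt_trans _ _ ((C + 1) * `|x - y|))//.
  by rewrite ler_wpM2r// lerDl.
rewrite -ltr_pdivlMl; last by rewrite ltr_wpDl.
near: y; apply: cvgr_dist_lt => //.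
by rewrite mulr_gt0// invr_gt0 ltr_wpDl.
Unshelve. all: by end_near. Qed.

Lemma dual_lincomb phi psi a : dual phi -> dual psi ->
  dual (fun x => phi x + a * psi x).
Proof.
move=> dphi dpsi; split=> [b x y|].
  by rewrite dphi.1 dpsi.1; ring.
have [C C0 phiC] := dual_bound dphi; have [D D0 psiD] := dual_bound dpsi.
exists (C + `|a| * D) => x; rewrite (le_trans (ler_normD _ _))// mulrDl lerD//.
by rewrite normrM -mulrA ler_wpM2l.
Qed.

Lemma dual_zero : dual (fun=> 0).
Proof. by split=> [a x y|]; [ring|exists 0 => x; rewrite normr0 mul0r]. Qed.

Lemma dual_scale phi a : dual phi -> dual (fun x => a * phi x).
Proof.
move=> dphi; have := dual_lincomb a dual_zero dphi.
by under [X in dual X -> _]eq_fun do rewrite add0r.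
Qed.

Lemma dual_linear phi : dual phi ->
  exists2 f : {linear E -> R^o}, continuous f & (f : E -> R) = phi.
Proof.
move=> dphi.
have lphi : linear (phi : E -> R^o) by move=> a x y; exact: dphi.1.
pose f : {linear E -> R^o} :=
  HB.pack (phi : E -> R^o) (GRing.isLinear.Build _ _ _ _ _ lphi).
by exists f => //; exact: dual_continuous.
Qed.

End dual_space.

(** * The Hahn-Banach theorem *)

Section hahn_banach.
Context {R : realType} {E : normedModType R}.

(** Graphs rather than functions on subspaces, so that Zorn's lemma applies to
    inclusion of sets. Domination makes such a graph functional: if (0, r)
    belongs to it, so does (0, - r), and both r and - r are at most 0. *)
Let dominated_graph (G : set (E * R)) : Prop :=
  [/\ G (0, 0),
      forall a x r y s, G (x, r) -> G (y, s) -> G (a *: x + y, a * r + s) &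
      forall x r, G (x, r) -> r <= `|x|].

(** Zorn's lemma yields a maximal dominated graph through (x0, |x0|). Its domain
    is the whole space because a missing point y can be given the value c, the
    supremum of the r - |x - y| over the points (x, r) of the graph. *)
Lemma norming_functional (x0 : E) :
  exists2 phi : E -> R, dual phi &
    phi x0 = `|x0| /\ forall x, `|phi x| <= `|x|.
Proof.
(* Graphs are required to stay dominated after addition of the line spanned by
   (x0, |x0|), so that the empty set, the union of the empty chain, qualifies. *)
pose P := [set G : set (E * R) |
  dominated_graph (G `|` [set p | exists a, p = (a *: x0, a * `|x0|)])].
have [|G [PG Gmax]] := @Zorn_bigcup _ P.
  move=> F FP Ftot; have base : dominated_graph [set p | exists a, p = (a *: x0, a * `|x0|)].
    split.
    - by exists 0; rewrite scale0r mul0r.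
    - move=> b x r y s [c [-> ->]] [d [-> ->]]; exists (b * c + d).
      by rewrite scalerDl scalerA; congr pair; ring.
    - by move=> x r [c [-> ->]]; rewrite normrZ ler_wpM2r// ler_norm.
  rewrite /P/=; have [->|/set0P[G0 FG0]] := eqVneq F set0.
    by rewrite bigcup_set0 set0U; exact: base.
  split.
  - by right; exists 0; rewrite scale0r mul0r.
  - move=> a x r y s xr ys.
    have [G [FG Gx Gy]] : exists G, [/\ F G,
        (G `|` [set p | exists a, p = (a *: x0, a * `|x0|)]) (x, r) &
        (G `|` [set p | exists a, p = (a *: x0, a * `|x0|)]) (y, s)].
      case: xr => [[G1 FG1 G1x]|xr]; case: ys => [[G2 FG2 G2y]|ys].
      + by have [G12|G21] := Ftot _ _ FG1 FG2; [exists G2|exists G1]; split => //;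
          left => //; [exact: G12|exact: G21].
      + by exists G1; split => //; [left|right].
      + by exists G2; split => //; [right|left].
      + by exists G0; split => //; right.
    have [_ /(_ a _ _ _ _ Gx Gy)[Ga|Ga] _] := FP _ FG; last by right.
    by left; exists G.
  - move=> x r [[G FG Gx]|Gx].
      by have [_ _] := FP _ FG; apply; left.
    by have [_ _] := base; apply.
move: PG; rewrite /P/=; set G' := _ `|` _ => -[G'0 G'lin G'dom].
have G'fun x r s : G' (x, r) -> G' (x, s) -> r = s.
  move=> xr xs; apply/eqP; rewrite eq_le.
  have := G'lin (-1) _ _ _ _ xr xs; have := G'lin (-1) _ _ _ _ xs xr.
  rewrite scaleN1r addNr => /G'dom + /G'dom; rewrite normr0; lra.
have G'all y : exists r, G' (y, r).
  apply: contrapT => /forallNP yNG.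
  (* c is the value given to y: any number lying above all the r - |x - y| and
     below all the |x + y| - r keeps the extended graph dominated. *)
  pose A := [set u | exists x r, G' (x, r) /\ u = r - `|x - y|].
  have Aub x r : G' (x, r) -> ubound A (`|x + y| - r).
    move=> Gx _ [x' [r' [Gx' ->]]].
    have := G'lin 1 _ _ _ _ Gx Gx'; rewrite scale1r mul1r => /G'dom.
    have : `|x + x'| <= `|x + y| + `|x' - y|.
      by rewrite (le_trans _ (ler_normD _ _))// addrACA subrr addr0.
    lra.
  have A0 : A !=set0 by exists (0 - `|0 - y|), 0, 0.
  pose c := sup A.
  have cub x r : G' (x, r) -> c <= `|x + y| - r.
    by move=> Gx; apply: ge_sup => //; exact: Aub.
  have clb x r : G' (x, r) -> r - `|x - y| <= c.
    move=> Gx; apply: ub_le_sup; last by exists x, r.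
    by exists (`|0 + y| - 0); exact: Aub.
  have dom x r a : G' (x, r) -> r + a * c <= `|x + a *: y|.
    move=> Gx; have [->|a0] := eqVneq a 0.
      by rewrite mul0r scale0r !addr0; exact: G'dom.
    have -> : x + a *: y = a *: (a^-1 *: x + y).
      by rewrite scalerDr scalerA divff// scale1r.
    rewrite normrZ; set N := `|a^-1 *: x + y|.
    have [{}a0|{}a0] : 0 < a \/ a < 0 by apply/orP; rewrite -neq_lt eq_sym.
    - have := G'lin a^-1 _ _ _ _ Gx G'0; rewrite !addr0 => /cub.
      rewrite -(ler_pM2l a0) mulrBr mulrA divff ?gt_eqF// mul1r gtr0_norm//.
      by rewrite -/N; lra.
    - have := G'lin (- a^-1) _ _ _ _ Gx G'0; rewrite !addr0 => /clb.
      rewrite scaleNr -opprD normrN -/N.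
      have Na0 : 0 < - a by rewrite oppr_gt0.
      rewrite -(ler_pM2l Na0) mulrBr mulrA mulrNN.
      by rewrite divff ?lt_eqF// mul1r ltr0_norm//; lra.
  pose K := [set p | exists x r a, G' (x, r) /\ p = (x + a *: y, r + a * c)].
  have G'K : G' `<=` K.
    by move=> [x r] Gx; exists x, r, 0; rewrite scale0r mul0r !addr0.
  apply: (Gmax K); first split.
  - by move=> p Gp; apply: G'K; left.
  - move=> KG; apply: (yNG c); left; apply: KG.
    by exists 0, 0, 1; rewrite !add0r scale1r mul1r.
  - rewrite /P/=; have -> : K `|` [set p | exists a, p = (a *: x0, a * `|x0|)] = K.
      by apply/setUidl => p Gp; apply: G'K; right.
    split; first exact: G'K.
    + move=> a _ _ _ _ [x1 [r1 [a1 [G1 [-> ->]]]]] [x2 [r2 [a2 [G2 [-> ->]]]]].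
      exists (a *: x1 + x2), (a * r1 + r2), (a * a1 + a2).
      split; first exact: G'lin.
      congr pair; last by ring.
      by rewrite scalerDr scalerDl scalerA addrACA.
    + by move=> _ _ [x [r [a [Gx [-> ->]]]]]; exact: dom.
pose phi y := projT1 (cid (G'all y)).
have phiG y : G' (y, phi y) by rewrite /phi; case: cid.
have philin a x y : phi (a *: x + y) = a * phi x + phi y.
  by apply: G'fun (phiG _) _; exact: G'lin.
have phi_le x : `|phi x| <= `|x|.
  rewrite ler_norml; have := G'dom _ _ (phiG x).
  have := G'dom _ _ (G'lin (-1) _ _ _ _ (phiG x) G'0).
  by rewrite !addr0 scaleN1r normrN; lra.
exists phi; last split=> //.
  by split => //; exists 1 => x; rewrite mul1r.
by apply: G'fun (phiG _) _; right; exists 1; rewrite scale1r mul1r.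
Qed.

Lemma dual_separates (x : E) : (forall phi, dual phi -> phi x = 0) -> x = 0.
Proof.
have [phi dphi [phix _]] := norming_functional x => /(_ _ dphi).
by rewrite phix => /normr0_eq0.
Qed.

End hahn_banach.

(** * Near-representation in Hilbert spaces *)

Lemma cvgn_dist_bound {R : realType} {V : completeNormedModType R}
    (u : nat -> V) (e : nat -> R) :
  e n @[n --> \oo] --> 0 -> (forall n m, `|u n - u m| <= e n + e m) -> cvgn u.
Proof.
move=> e0 ue; apply/cauchy_cvgP/cauchyP => r r0.
have [N _ eN] : \forall n \near \oo, e n < r / 2.
  by apply: (cvgr_lt 0) => //; rewrite divr_gt0.
exists (u N); exists N => // n /= Nn.
rewrite -ball_normE /ball_/= (le_lt_trans (ue _ _))//.
by rewrite [ltRHS](splitr r) ltrD//; apply: eN => /=.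
Qed.

Lemma cvg_dist_le {R : realType} {V : normedModType R} (u : nat -> V)
    (d : nat -> R) (l : V) :
  (forall n, `|l - u n| <= d n) -> d n @[n --> \oo] --> 0 ->
  u n @[n --> \oo] --> l.
Proof.
move=> ud d0; apply/cvgrPdist_lt => e e0.
by near=> n; rewrite (le_lt_trans (ud n))//; near: n; exact: (cvgr_lt 0).
Unshelve. all: by end_near. Qed.

Section riesz.
Context {R : realType}.

(** A discriminant estimate: minimise over a. *)
Lemma quadratic_bound (e b q : R) : 0 <= e -> 0 <= q ->
  (forall a, - e ^+ 2 / 2 <= a * b + a ^+ 2 * q / 2) ->
  `|b| <= e * Num.sqrt q.
Proof.
move=> e0 q0 eab; have [q0'|q0'] := eqVneq q 0.
  rewrite q0' sqrtr0 mulr0 normr_le0; apply/eqP; apply: contrapT => /eqP b0.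
  have := eab (- (e ^+ 2 + 1) / b).
  rewrite q0' mulr0 mul0r addr0 divfK//.
  have := sqr_ge0 e; lra.
have {q0'}q0 : 0 < q by rewrite lt_def q0' q0.
have := eab (- b / q).
have -> : - b / q * b + (- b / q) ^+ 2 * q / 2 = - (b ^+ 2 / q) / 2.
  by field; rewrite gt_eqF.
move=> beq; have {}beq : b ^+ 2 <= e ^+ 2 * q.
  by rewrite -ler_pdivrMr//; lra.
rewrite -sqrtr_sqr -[e]ger0_norm// -[`|e|]sqrtr_sqr -sqrtrM ?sqr_ge0//.
exact: ler_wsqrtr.
Qed.

(** The Riesz representation theorem without completeness: a near-minimiser u of
    B v v / 2 - l v nearly satisfies the Euler-Lagrange equation B u = l. It
    applies both to the inner product of H and to the dual of E with the
    covariance form of a Gaussian measure, which is not complete in general. *)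
Lemma approx_riesz (V : lmodType R) (D : set V) (B : V -> V -> R) (l : V -> R)
    (C : R) :
  0 <= C -> D 0 -> (forall a u v, D u -> D v -> D (u + a *: v)) ->
  (forall a u v, D u -> D v ->
    B (u + a *: v) (u + a *: v) = B u u + 2 * a * B u v + a ^+ 2 * B v v) ->
  (forall v, D v -> 0 <= B v v) ->
  (forall a u v, D u -> D v -> l (u + a *: v) = l u + a * l v) ->
  (forall v, D v -> `|l v| <= C * Num.sqrt (B v v)) ->
  forall e, 0 < e -> exists u, [/\ D u,
    forall v, D v -> `|B u v - l v| <= e * Num.sqrt (B v v) &
    Num.sqrt (B u u) <= C + e].
Proof.
move=> C0 D0 Dlin BD B0 lD lC e e0.
pose J v := B v v / 2 - l v.
have Jlb v : D v -> - C ^+ 2 / 2 <= J v.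
  move=> Dv; have := lC _ Dv; have := sqr_sqrtr (B0 _ Dv).
  set s := Num.sqrt _ => Bs; rewrite /J -Bs ler_norml => /andP[_ lvC].
  by have := sqr_ge0 (s - C); lra.
have infJ : has_inf (J @` D).
  split; first by exists (J 0), 0.
  by exists (- C ^+ 2 / 2) => _ [v Dv <-]; exact: Jlb.
have e20 : 0 < e ^+ 2 / 2 by rewrite divr_gt0// exprn_gt0.
have [_ [u Du <-] Ju] := inf_adherent e20 infJ.
have uP v : D v -> `|B u v - l v| <= e * Num.sqrt (B v v).
  move=> Dv; apply: quadratic_bound; [exact: ltW|exact: B0|move=> a].
  have : inf (J @` D) <= J (u + a *: v).
    apply: ge_inf; first exact: infJ.2.
    by exists (u + a *: v) => //; exact: Dlin.
  by move: Ju; rewrite /J BD// lD//; lra.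
exists u; split => //.
have := uP _ Du; have := lC _ Du; have := sqr_sqrtr (B0 _ Du).
have := sqrtr_ge0 (B u u); set s := Num.sqrt _ => s0 <-.
rewrite !ler_norml => /andP[_ h1] /andP[_ h2].
have [->|s0'] := eqVneq s 0; first by rewrite addr_ge0// ltW.
by rewrite -(@ler_pM2r _ s) ?lt_def ?s0'//; lra.
Qed.

End riesz.

Section hilbert.
Context {R : realType} {H : completeNormedModType R}.
Variables (ip : {dot H for idfun}) (hip : induces_norm ip).

Lemma ipC (u v : H) : ip u v = ip v u.
Proof. by rewrite hermC/= expr0 mul1r. Qed.

Lemma ipDl a (u v w : H) : ip (u + a *: v) w = ip u w + a * ip v w.
Proof. by rewrite linearDl/= linearZl_LR. Qed.

Lemma ipDr a (u v w : H) : ip w (u + a *: v) = ip w u + a * ip w v.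
Proof. by rewrite ipC ipDl !(ipC w). Qed.

Lemma sqr_normD a (u v : H) :
  `|u + a *: v| ^+ 2 = `|u| ^+ 2 + 2 * a * ip u v + a ^+ 2 * `|v| ^+ 2.
Proof. by rewrite -!hip ipDl !ipDr (ipC v u); ring. Qed.

Lemma ip_cauchy_schwarz (u v : H) : `|ip u v| <= `|u| * `|v|.
Proof.
rewrite -[X in _ <= _ * X]normr_id -[X in _ <= _ * X]sqrtr_sqr.
apply: quadratic_bound; [by []|exact: sqr_ge0|move=> a].
by have := sqr_ge0 `|u + a *: v|; rewrite sqr_normD; lra.
Qed.

(** The images under A of the near-representers at precision 1 / (n + 1) form a
    Cauchy sequence in H, and its limit represents l. With A the identity this is
    the Riesz theorem; with A = istar it is the criterion for a point of E to lie
    in the image of H. *)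
Lemma riesz_on_range (V : lmodType R) (D : set V) (A : V -> H) (l : V -> R)
    (C : R) :
  D 0 -> (forall a u v, D u -> D v -> D (u + a *: v)) ->
  (forall a u v, D u -> D v -> A (u + a *: v) = A u + a *: A v) ->
  (forall a u v, D u -> D v -> l (u + a *: v) = l u + a * l v) ->
  (forall v, D v -> `|l v| <= C * `|A v|) ->
  exists h, forall v, D v -> ip h (A v) = l v.
Proof.
move=> D0 Dlin AD lD lC.
have sqrtip h : Num.sqrt (ip h h) = `|h| by rewrite hip sqrtr_sqr normr_id.
have /choice[u uP] : forall n : nat, exists u, D u /\
    forall v, D v -> `|ip (A u) (A v) - l v| <= n.+1%:R^-1 * `|A v|.
  move=> n; have := @approx_riesz R V D (fun u v => ip (A u) (A v)) l `|C| (normr_ge0 C) D0 Dlin.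
  move=> /(_ _ _ lD _ n.+1%:R^-1)[||||u [Du uP _]] //.
  - by move=> a u v Du Dv; rewrite AD// !hip sqr_normD.
  - by move=> v _; rewrite hip sqr_ge0.
  - by move=> v Dv; rewrite sqrtip (le_trans (lC v Dv))// ler_wpM2r// ler_norm.
  by exists u; split => // v Dv; rewrite -(sqrtip (A v)) uP.
have Au_dist n m : `|A (u n) - A (u m)| <= n.+1%:R^-1 + m.+1%:R^-1.
  have [Dn un] := uP n; have [Dm um] := uP m.
  have Dnm := Dlin (-1) _ _ Dn Dm.
  have := un _ Dnm; have := um _ Dnm; rewrite AD// scaleN1r.
  set w := A (u n) - A (u m) => h1 h2.
  have : `|w| ^+ 2 <= (n.+1%:R^-1 + m.+1%:R^-1) * `|w|.
    have -> : `|w| ^+ 2 = ip (A (u n)) w - ip (A (u m)) w.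
      by rewrite -hip {1}/w -scaleN1r ipDl mulN1r.
    move: n.+1%:R^-1 m.+1%:R^-1 h1 h2 => en em.
    by rewrite !ler_norml => /andP[h1 h1'] /andP[h2 h2']; lra.
  have [->|w0] := eqVneq `|w| 0; first by rewrite addr_ge0.
  by rewrite expr2 ler_pM2r// lt_def w0 normr_ge0.
have Aucvg : cvgn (A \o u).
  exact: (cvgn_dist_bound (@cvg_harmonic R)).
exists (limn (A \o u)) => v Dv.
have Auv : ip (A (u n)) (A v) @[n --> \oo] --> l v.
  apply: (@cvg_dist_le _ R^o _ (fun n => n.+1%:R^-1 * `|A v|)) => [n|].
    by rewrite distrC; have [_] := uP n; exact.
  by rewrite -(mul0r `|A v|); apply: cvgMl; exact: cvg_harmonic.
have ip_cvg : ip (A (u n)) (A v) @[n --> \oo] --> ip (limn (A \o u)) (A v).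
  apply: (@cvg_dist_le _ R^o _ (fun n => `|limn (A \o u) - A (u n)| * `|A v|)) => [n|].
    rewrite -mulN1r -ipDl scaleN1r; exact: ip_cauchy_schwarz.
  rewrite -(mul0r `|A v|); apply: cvgMl; rewrite -(@normr0 _ H) -(subrr (limn (A \o u))).
  by apply: cvg_norm; apply: cvgB => //; exact: cvg_cst.
exact: cvg_unique ip_cvg Auv.
Qed.

End hilbert.

(** * Strongly continuous semigroups *)

(** The Banach-Steinhaus theorem with the bound in the form of an operator norm. *)
Lemma uniform_boundedness {R : realType} {V : completeNormedModType R}
    {W : normedModType R} (F : set (V -> W)) :
  (forall f, F f -> linear f /\ exists C, forall x, `|f x| <= C * `|x|) ->
  (forall x, exists M, forall f, F f -> `|f x| <= M) ->
  exists2 C, 0 <= C & forall f, F f -> forall x, `|f x| <= C * `|x|.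
Proof.
move=> Flin Fpt.
have [|//|M FM] := Banach_Steinhauss (F := F) _ _ 1.
- move=> f Ff; have [flin [C fC]] := Flin f Ff; split => // r.
  exists (`|C| * r) => x xr; rewrite (le_trans (fC x))//.
  by rewrite (le_trans (ler_wpM2r _ (ler_norm C)))// ler_wpM2l.
exists `|M| => // f Ff x; have [flin _] := Flin f Ff.
have fZ a y : f (a *: y) = a *: f y.
  have f0 : f 0 = 0.
    by have := flin (-1) 0 0; rewrite !scaleN1r oppr0 addr0 addNr.
  by have := flin a y 0; rewrite !addr0 f0 addr0.
have [->|x0] := eqVneq x 0.
  by rewrite normr0 mulr0 -(scale0r 0) fZ scale0r normr0.
have := FM f Ff (`|x|^-1 *: x).
rewrite fZ !normrZ normfV normr_id mulVf ?normr_eq0// => /(_ (lexx 1)).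
rewrite ler_pdivrMl ?normr_gt0// mulrC => /le_trans; apply.
by rewrite ler_wpM2r// ler_norm.
Qed.

Section C0_semigroup.
Context {R : realType} {V : completeNormedModType R}.
Variables (S : R -> {linear V -> V}) (hS : C0_semigroup S).

Lemma C0_bounded_op t : 0 <= t -> exists C, forall x, `|S t x| <= C * `|x|.
Proof.
move=> /(C0_bounded hS)/linear_bounded_continuous/linear_boundedP.
by move=> /pinfty_ex_gt0[C _ SC]; exists C.
Qed.

Lemma C0_right_limit x e : 0 < e ->
  exists2 d, 0 < d & forall s, 0 <= s -> s < d -> `|x - S s x| < e.
Proof.
move=> e0; have /cvgrPdist_lt/(_ e e0) := @C0_strongly_continuous _ _ _ hS x.
move=> [d /= d0 dS]; exists d => // s; rewrite le_eqVlt => /predU1P[<- _|s0 sd].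
  by rewrite (C0_at0 hS) subrr normr0.
by apply: dS => //=; rewrite sub0r normrN gtr0_norm.
Qed.

(** If the operators were unbounded near 0, there would be times tending to 0
    along which the norms tend to infinity, although each orbit converges along
    these times. *)
Let bounded_near0 :
  exists2 d, 0 < d & exists2 C, 1 <= C &
    forall s, 0 <= s -> s <= d -> forall x, `|S s x| <= C * `|x|.
Proof.
apply: contrapT => nobound.
have /choice[sx sxP] : forall n : nat, exists p : R * V,
    [/\ 0 <= p.1, p.1 <= n.+1%:R^-1 & n.+1%:R * `|p.2| < `|S p.1 p.2|].
  move=> n; apply: contrapT => /forallNP nosx; apply: nobound.
  exists n.+1%:R^-1 => //; exists n.+1%:R; first by rewrite ler1n.
  move=> s s0 sn x; rewrite leNgt; apply/negP => xS.
  by apply: (nosx (s, x)).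
have Spt x : exists M, forall f, range (fun n => S (sx n).1 : V -> V) f -> `|f x| <= M.
  have : cvgn (fun n => S (sx n).1 x).
    apply/cvg_ex; exists x; apply/cvgrPdist_lt => e e0.
    have [d d0 dS] := C0_right_limit x e0.
    near=> n; have [s0 sn _] := sxP n; apply: dS => //.
    rewrite (le_lt_trans sn)//; near: n.
    exact: (near_infty_natSinv_lt (PosNum d0)).
  move=> /cvg_seq_bounded/pinfty_ex_gt0[M _ SM].
  by exists M => _ [n _ <-]; apply: SM.
have [f [n _ <-]|C C0 SC] := uniform_boundedness _ Spt.
  have [s0 _ _] := sxP n; split; last exact: C0_bounded_op.
  by move=> a x y; rewrite linearP.
pose n := Num.truncn C; have [_ _] := sxP n.
apply/negP; rewrite -leNgt.
rewrite (le_trans (SC _ (ex_intro2 _ _ n Logic.I erefl) _))//.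
by rewrite ler_wpM2r// ltW// truncnS_gt.
Unshelve. all: by end_near. Qed.

(** On [0, n d] the bound is C ^ n, where C bounds the operators on [0, d]. *)
Lemma C0_locally_bounded t :
  exists2 C, 0 <= C &
    forall s, 0 <= s -> s <= t -> forall x, `|S s x| <= C * `|x|.
Proof.
have [d d0 [C C1 SC]] := bounded_near0.
have C0 : 0 <= C by rewrite (le_trans _ C1).
have pow n : forall s, 0 <= s -> s <= n%:R * d -> forall x, `|S s x| <= C ^+ n * `|x|.
  elim: n => [|n IHn] s s0 sn x.
    have -> : s = 0 by apply/eqP; rewrite eq_le s0 andbT -(mul0r d).
    by rewrite (C0_at0 hS) expr0 mul1r.
  have [sd|ds] := leP s d.
    rewrite (le_trans (SC s s0 sd x))// ler_wpM2r// exprS ler_peMr//.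
    exact: exprn_ege1.
  have -> : s = d + (s - d) by rewrite addrC subrK.
  have sd0 : 0 <= s - d by rewrite subr_ge0 ltW.
  rewrite (C0_add hS) ?(ltW d0)//.
  rewrite (le_trans (SC _ (ltW d0) (lexx _) _))//.
  rewrite exprS -mulrA ler_wpM2l// IHn//.
  by rewrite lerBlDr -[X in _ + X]mul1r -mulrDl -natr1 in sn *.
pose n := (Num.truncn (t / d)).+1.
exists (C ^+ n); first exact: exprn_ge0.
move=> s s0 st; apply: pow => //; rewrite (le_trans st)//.
by rewrite -ler_pdivrMr// ltW// truncnS_gt.
Qed.

(** The orbit is frozen on the negative half-line: continuity on the whole line
    then says that it is continuous on the right at 0 and continuous elsewhere. *)
Lemma C0_orbit_continuous x : continuous (fun s : R => S (Num.max 0 s) x).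
Proof.
move=> s0; have [C C0 SC] := C0_locally_bounded (`|s0| + 1).
apply/cvgrPdist_lt => e e0.
have eC0 : 0 < e / (C + 1) by rewrite divr_gt0// ltr_wpDl.
have [d d0 dS] := C0_right_limit x eC0.
have diff s r : 0 <= s -> s <= r -> r <= `|s0| + 1 -> r - s < d ->
    `|S s x - S r x| < e.
  move=> s0' sr rt rsd; rewrite -{1}(subrK s r) [r - s + s]addrC.
  rewrite (C0_add hS) ?subr_ge0// -linearB.
  rewrite (le_lt_trans (SC _ _ _ _)) ?(le_trans sr)//.
  have := dS (r - s); rewrite subr_ge0 => /(_ sr rsd).
  rewrite ltr_pdivlMr ?ltr_wpDl// mulrC => /(le_lt_trans _); apply.
  by rewrite ler_wpM2r// lerDl.
near=> s.
have ss0 : `|s0 - s| < Num.min d 1.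
  by near: s; apply: cvgr_dist_lt => //; rewrite lt_min d0 ltr01.
move: ss0; rewrite lt_min !ltr_norml => /andP[/andP[h1 h2] /andP[h3 h4]].
have h5 := ler_norm s0; have h6 := normr_ge0 s0.
set a := Num.max 0 s0; set b := Num.max 0 s.
have a0 : 0 <= a by rewrite le_max lexx.
have b0 : 0 <= b by rewrite le_max lexx.
have at' : a <= `|s0| + 1 by rewrite /a; case: (leP 0 s0) => ?; lra.
have bt' : b <= `|s0| + 1 by rewrite /b; case: (leP 0 s) => ?; lra.
have abd : a - b < d by rewrite /a /b; case: (leP 0 s0) => ?; case: (leP 0 s) => ?; lra.
have bad : b - a < d by rewrite /a /b; case: (leP 0 s0) => ?; case: (leP 0 s) => ?; lra.
have [ab|ba] := leP a b; first exact: diff.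
by rewrite distrC; apply: diff => //; exact: ltW.
Unshelve. all: by end_near. Qed.

End C0_semigroup.

(** * Weak measurability in separable spaces *)

Section separable_space.
Context {R : realType} {E : normedModType R}.
Hypothesis hE : separable E.

Lemma separable_dense_seq :
  exists d : nat -> E, forall x e, 0 < e -> exists n, `|x - d n| < e.
Proof.
have [A /pfcard_geP[A0|[f]] Adense] := hE.
  have := Adense setT; rewrite A0 setI0 => -[].
  - by exists 0.
  - exact: openT.
  - by move=> x [].
exists f => x e e0.
have [|y [xy /(@surj _ _ _ _ f)[n _ fn]]] := Adense (ball x e) _ (ball_open x e).
  by exists x; exact: ballxx.
by exists n; rewrite fn; move: xy; rewrite -ball_normE.
Qed.

(** Norming functionals of a dense sequence recover every norm, because
    phi n (x) is at least |d n| - |x - d n|. *)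
Lemma separable_norming_seq : exists phi : nat -> E -> R,
  [/\ forall n, dual (phi n), forall n x, `|phi n x| <= `|x| &
      forall x e, 0 < e -> exists n, `|x| - e < phi n x].
Proof.
have [d dP] := separable_dense_seq.
have /choice[phi phiP] : forall n, exists phi, [/\ dual phi, phi (d n) = `|d n| &
    forall x, `|phi x| <= `|x|].
  by move=> n; have [phi dphi [? ?]] := norming_functional (d n); exists phi.
exists phi; split=> [n|n|x e e0]; [by have [] := phiP n|by have [] := phiP n|].
have [n xn] := dP x (e / 2) (divr_gt0 e0 (ltr0Sn _ _)).
exists n; have [dn phin philt] := phiP n.
have := philt (x - d n); rewrite dualB// phin ler_norml => /andP[h _].
have : `|x| <= `|d n| + `|x - d n| by rewrite (le_trans _ (ler_normD _ _))// addrC subrK.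
by move: xn h; lra.
Qed.

(** Half of Pettis' theorem: the norm is a supremum of countably many
    functionals. *)
Lemma measurable_norm_weak d (T : measurableType d) (D : set T) (f : T -> E) :
  measurable D ->
  (forall psi, dual psi -> measurable_fun D (psi \o f)) ->
  forall y, measurable_fun D (fun s => `|f s - y|).
Proof.
move=> mD mf y; have [phi [dphi phi_le phi_sup]] := separable_norming_seq.
pose h n s := phi n (f s - y).
have hub s : has_ubound (range (h ^~ s)).
  by exists `|f s - y| => _ [n _ <-]; rewrite (le_trans (ler_norm _))// phi_le.
have -> : (fun s => `|f s - y|) = (fun s => sups (h ^~ s) 0%N).
  apply/funext => s; apply/eqP; rewrite eq_le; apply/andP; split.
    apply/ler_addgt0Pr => e e0; have [n hn] := phi_sup (f s - y) e e0.
    rewrite -lerBlDr (le_trans (ltW hn))//; apply: ub_le_sup; last by exists n.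
    by have [M hM] := hub s; exists M => _ [k _ <-]; apply: hM; exists k.
  apply: ge_sup; first by exists (h 0%N s), 0%N.
  by move=> _ [n _ <-]; rewrite (le_trans (ler_norm _))// phi_le.
apply: measurable_fun_sups => [//|m].
rewrite (_ : h m = (fun s => (phi m \o f) s - phi m y)); last first.
  by apply/funext => s; rewrite /h dualB.
by apply: measurable_funB => //; exact: mf.
Qed.

End separable_space.

(** * Bochner integrals of bounded weakly measurable functions *)

Section bochner_theory.
Context {d : measure_display} {T : measurableType d} {R : realType}
  {E : completeNormedModType R}.
Variables (m : {measure set T -> \bar R}) (D : set T).
Hypothesis (mD : measurable D) (fD : (m D < +oo)%E).

Lemma bounded_integrable (f : T -> R) M : measurable_fun D f ->
  (forall x, D x -> `|f x| <= M) -> m.-integrable D (EFin \o f).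
Proof.
move=> mf fM; apply: measurable_bounded_integrable => //.
exists M; split; first exact: num_real.
by move=> r Mr x Dx; rewrite /= (le_trans (fM x Dx))// ltW.
Qed.

Lemma Rintegral_indic_sum (I : Type) (r : seq I) (c : I -> R) (A : I -> set T) :
  (forall i, measurable (D `&` A i)) ->
  m.-integrable D (EFin \o (fun x => \sum_(i <- r) c i * \1_(A i) x)) /\
  \int[m]_(x in D) (\sum_(i <- r) c i * \1_(A i) x) =
  \sum_(i <- r) c i * fine (m (D `&` A i)).
Proof.
move=> mA.
have iA i : m.-integrable D (EFin \o \1_(A i)).
  apply: (@bounded_integrable _ 1) => [|x _].
    apply: (eq_measurable_fun (\1_(D `&` A i) : T -> R)).
      by move=> x /set_mem Dx; rewrite !indicE in_setI (mem_set Dx).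
    exact: measurable_indic.
  by rewrite indicE; case: (_ \in _); rewrite ?normr1 ?normr0.
have RiA i : \int[m]_(x in D) \1_(A i) x = fine (m (D `&` A i)).
  rewrite (@eq_Rintegral _ _ _ _ _ (\1_(D `&` A i) : T -> R)); last first.
    by move=> x /set_mem Dx; rewrite !indicE in_setI (mem_set Dx).
  by rewrite /Rintegral integral_indic// setIAC setIid.
elim: r => [|i r [IHi IHr]].
  under eq_fun do rewrite big_nil.
  rewrite big_nil; split.
    by apply: (@bounded_integrable (cst 0) 0) => // x _; rewrite /= normr0.
  by rewrite Rintegral_cst// mul0r.
rewrite big_cons -IHr -RiA -RintegralZl//.
have iic : m.-integrable D (EFin \o (fun x => c i * \1_(A i) x)).
  exact: (integrableZl mD (c i) (iA i)).
rewrite -RintegralD//; split.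
  under eq_fun do rewrite big_cons.
  exact: (integrableD mD iic IHi).
by apply: eq_Rintegral => x _; rewrite big_cons.
Qed.

Lemma dual_sum (phi : E -> R) (I : Type) (r : seq I) (F : I -> E) :
  dual phi -> phi (\sum_(i <- r) F i) = \sum_(i <- r) phi (F i).
Proof.
move=> dphi; elim: r => [|i r IH]; first by rewrite !big_nil dual0.
by rewrite !big_cons dualD// IH.
Qed.

(** Functionals reduce Bochner integrals of simple functions to real integrals,
    for which additivity is known. *)
Lemma dual_bochner_simple_integral (g : T -> E) (phi : E -> R) :
  dual phi -> bochner_simple m D g ->
  m.-integrable D (EFin \o (phi \o g)) /\
  phi (bochner_simple_integral m D g) = \int[m]_(x in D) phi (g x).
Proof.
move=> dphi [gfin gm _].
rewrite /bochner_simple_integral fsbig_finite//= dual_sum//.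
set r := finmap.enum_fset _.
have phig : {in D, phi \o g =1
    (fun x => \sum_(y <- r) phi y * \1_(g @^-1` [set y]) x)}.
  move=> x /set_mem Dx; rewrite (bigD1_seq (g x))/=.
  - rewrite indicE mem_set// mulr1 big1 ?addr0// => y yx.
    rewrite indicE (_ : (x \in _) = false) ?mulr0//.
    by apply/negP => /set_mem /= gxy; rewrite gxy eqxx in yx.
  - by rewrite /r in_fset_set// mem_set//; exists x.
  - exact: finmap.fset_uniq.
have [igsum gsum] := Rintegral_indic_sum r phi (A := fun y => g @^-1` [set y]) gm.
split.
  by apply: eq_integrable igsum => // x xD /=; rewrite -phig.
rewrite (eq_Rintegral _ phig) gsum.
by apply: eq_bigr => y _; rewrite dualZ// mulrC.
Qed.


Hypothesis hE : separable E.
Variables (f : T -> E) (M : R).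
Hypotheses (mf : forall phi, dual phi -> measurable_fun D (phi \o f))
  (fM : forall x, D x -> `|f x| <= M).

Lemma dual_integrable phi : dual phi -> m.-integrable D (EFin \o (phi \o f)).
Proof.
move=> dphi; have [C C0 phiC] := dual_bound dphi.
apply: (@bounded_integrable _ (C * M)) => [|x Dx]; first exact: mf.
by rewrite /= (le_trans (phiC _))// ler_wpM2l// fM.
Qed.

(** This estimate serves twice: it identifies the value of a functional on the
    integral, and with norming functionals it shows that the integrals of
    approximating simple functions form a Cauchy sequence. *)
Lemma dual_bochner_dist (g : T -> E) (phi : E -> R) (C : R) :
  dual phi -> 0 <= C -> (forall x, `|phi x| <= C * `|x|) -> bochner_simple m D g ->
  (`|phi (bochner_simple_integral m D g) - \int[m]_(x in D) phi (f x)|%:E <=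
   C%:E * \int[m]_(x in D) (`|f x - g x|)%:E)%E.
Proof.
move=> dphi C0 phiC sg.
have [ig ->] := dual_bochner_simple_integral dphi sg.
have iphif := dual_integrable dphi.
rewrite distrC -RintegralB//.
have iB : m.-integrable D (EFin \o (fun x => phi (f x) - phi (g x))).
  exact: (integrableB mD iphif ig).
rewrite (le_trans (y := (\int[m]_(x in D) `|phi (f x) - phi (g x)|%:E)%E))//.
  rewrite EFin_normr_Rintegral//; exact: (le_abse_integral m mD (measurable_int _ iB)).
have mfg : measurable_fun D (fun x => `|f x - g x|).
  rewrite (_ : (fun x => _) = (fun x => `|(f x - g x) - 0|)); last first.
    by apply/funext => x; rewrite subr0.
  apply: measurable_norm_weak => // psi dpsi.
  have [ig' _] := dual_bochner_simple_integral dpsi sg.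
  rewrite (_ : _ \o _ = (psi \o f) \- (psi \o g)); last first.
    by apply/funext => x; rewrite /= dualB.
  apply: measurable_funB; first exact: mf.
  by apply/measurable_EFinP; exact: measurable_int ig'.
rewrite -ge0_integralZl_EFin//; last exact/measurable_EFinP.
apply: ge0_le_integral => //.
- by apply/measurable_EFinP; apply: measurableT_comp => //;
    apply/measurable_EFinP; exact: (measurable_int _ iB).
- by apply/measurable_EFinP; exact: measurable_funM.
- by move=> x Dx; rewrite -EFinM lee_fin -dualB.
Qed.

Lemma dual_bochner_integral v phi : dual phi -> is_bochner_integral m D f v ->
  phi v = \int[m]_(x in D) phi (f x).
Proof.
move=> dphi [g [sg _ g0 gv]].
have [C C0 phiC] := dual_bound dphi.
set c := \int[m]_(x in D) _.
have phiv : phi (bochner_simple_integral m D (g n)) @[n --> \oo] --> phi v.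
  by apply: continuous_cvg => //; exact: dual_continuous.
apply: (cvg_unique _ phiv) => //.
have : (`|phi (bochner_simple_integral m D (g n)) - c|%:E)%E @[n --> \oo] --> 0%:E.
  apply: (@squeeze_cvge _ _ _ _ (cst 0%E) _
      (fun n => C%:E * \int[m]_(x in D) (`|f x - g n x|)%:E)%E).
  - by near=> n; rewrite lee_fin normr_ge0 dual_bochner_dist.
  - exact: cvg_cst.
  - by have := @cvgeZl _ _ _ _ _ C%:E isT g0; rewrite mule0; apply.
move=> /fine_cvg h; apply: (@cvg_dist_le _ R^o _ _ _ _ h) => n.
by rewrite distrC.
Unshelve. all: by end_near. Qed.

(** The point nearest to z among a 0, ..., a n, ties going to the smaller
    index. *)
Fixpoint nearest (a : nat -> E) n (z : E) : E :=
  if n is k.+1 then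
    if `|z - a k.+1| < `|z - nearest a k z| then a k.+1 else nearest a k z
  else a 0%N.

Lemma nearest_range a n z : exists k, nearest a n z = a k /\ (k < n.+1)%N.
Proof.
elim: n => [|n [k [nk kn]]] /=; first by exists 0%N.
by case: ifP => _; [exists n.+1|exists k; split => //; exact: ltnW].
Qed.

Lemma nearest_min a n k z : (k <= n)%N -> `|z - nearest a n z| <= `|z - a k|.
Proof.
elim: n k => [|n IH] k /=; first by rewrite leqn0 => /eqP->.
rewrite leq_eqVlt => /predU1P[->|/IH {}IH]; first by case: ltP => // /ltW.
by case: ltP => // /ltW h; rewrite (le_trans _ IH).
Qed.

Lemma nearest_dist_measurable a n :
  measurable_fun D (fun s => `|f s - nearest a n (f s)|).
Proof.
have mfa := measurable_norm_weak hE mD mf.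
elim: n => [|n IH] /=; first exact: mfa.
rewrite (_ : (fun s => _) =
  (fun s => `|f s - a n.+1|) \min (fun s => `|f s - nearest a n (f s)|)).
  by apply: measurable_minr => //; exact: mfa.
by apply/funext => s /=; rewrite minEle; case: ltgtP.
Qed.

Lemma nearest_measurable a n y :
  measurable (D `&` (nearest a n \o f) @^-1` [set y]).
Proof.
have mfa := measurable_norm_weak hE mD mf.
elim: n => [|n IH] /=.
  have [<-|ay] := eqVneq (a 0%N) y.
    by rewrite (_ : _ @^-1` _ = setT) ?setIT//; apply/seteqP.
  rewrite (_ : _ @^-1` _ = set0) ?setI0//.
  by rewrite -subset0 => x /= ayx; rewrite ayx eqxx in ay.
pose L := D `&` [set s | `|f s - a n.+1| < `|f s - nearest a n (f s)|].
have mL : measurable L.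
  have := measurable_fun_ltr (mfa (a n.+1)) (nearest_dist_measurable a n).
  by move=> /(_ mD [set true] Logic.I).
rewrite (_ : _ `&` _ = (L `&` [set s | a n.+1 = y]) `|`
    ((D `&` (nearest a n \o f) @^-1` [set y]) `\` L)); last first.
  apply/seteqP; split => s /=.
    by case: ifPn => [lt [Ds <-]|nlt [Ds <-]]; [left|right; split => // -[_]; apply/negP].
  move=> [[[Ds lt] <-]|[[Ds <-] nL]]; first by rewrite lt.
  by case: ifPn => // lt; exfalso; apply: nL.
apply: measurableU; last exact: measurableD.
have [ay|ay] := pselect (a n.+1 = y).
  by rewrite (_ : [set s | _] = setT) ?setIT//; apply/seteqP; split.
by rewrite (_ : [set s | _] = set0) ?setI0// -subset0.
Qed.

(** The simple functions send s to the point nearest to f s among the first n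
    terms of a dense sequence: they converge everywhere, and within M + |a 0| of
    f, so that dominated convergence applies. *)
Lemma bochner_integral_exists : exists v, is_bochner_integral m D f v.
Proof.
have [a aP] := separable_dense_seq hE.
pose g n := nearest a n \o f.
have sg n : bochner_simple m D (g n).
  split.
  - apply: (@sub_finite_set _ _ [set a k | k in `I_n.+1]).
      by move=> _ [s _ <-]; rewrite /g /=; have [k [-> kn]] := nearest_range a n (f s); exists k.
    exact: finite_image.
  - by move=> y; exact: nearest_measurable.
  - move=> y _; rewrite (le_lt_trans _ fD)//; apply: le_measure; rewrite ?inE//.
    by apply: nearest_measurable.
have g_cvg s : g n s @[n --> \oo] --> f s.
  apply/cvgrPdist_lt => e e0; have [k fk] := aP (f s) e e0.
  by exists k => // n kn; rewrite (le_lt_trans _ fk)//; exact: nearest_min.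
have fg_le n x : D x -> `|f x - g n x| <= M + `|a 0%N|.
  move=> Dx; rewrite (le_trans (nearest_min a _ (leq0n n)))//.
  by rewrite (le_trans (ler_normB _ _))// lerD2r fM.
have icst r : m.-integrable D (EFin \o cst r).
  by apply: (@bounded_integrable _ `|r|).
have mfg n : measurable_fun D (fun x => `|f x - g n x|).
  exact: nearest_dist_measurable.
have ifg n : m.-integrable D (EFin \o (fun x => `|f x - g n x|)).
  by apply: (bounded_integrable (mfg n)) => x Dx; rewrite normr_id; exact: fg_le.
have g0 : (\int[m]_(x in D) (`|f x - g n x|)%:E)%E @[n --> \oo] --> (0 : \bar R).
  have := @dominated_cvg _ _ _ m D mD (fun n x => `|f x - g n x|%:E) (cst 0%E)
    (cst (M + `|a 0%N|)%:E).
  rewrite integral0; apply=> [n|x Dx|//||n x Dx].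
  - exact/measurable_EFinP.
  - apply: cvg_EFin; first exact: nearW.
    rewrite -(@normr0 _ E) -(subrr (f x)).
    by apply: cvg_norm; apply: cvgB; [exact: cvg_cst|exact: g_cvg].
  - exact: icst.
  - by rewrite /= lee_fin normr_id fg_le.
pose e n := fine (\int[m]_(x in D) (`|f x - g n x|)%:E)%E.
have dist_e phi n : dual phi -> (forall x, `|phi x| <= 1 * `|x|) ->
    `|phi (bochner_simple_integral m D (g n)) - \int[m]_(x in D) phi (f x)| <= e n.
  move=> dphi phi1; rewrite -lee_fin /e fineK; last exact: integrable_fin_num (ifg n).
  by rewrite -[leRHS]mul1e; exact: dual_bochner_dist.
have /cvg_ex[v gv] : cvgn (fun n => bochner_simple_integral m D (g n)).
  apply: (@cvgn_dist_bound _ _ _ e) => [|n k].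
    exact: (fine_cvg g0).
  have [phi dphi [<- phi1]] := norming_functional
    (bochner_simple_integral m D (g n) - bochner_simple_integral m D (g k)).
  have phi1' x : `|phi x| <= 1 * `|x| by rewrite mul1r.
  have := dist_e _ n dphi phi1'; have := dist_e _ k dphi phi1'.
  by rewrite dualB// !ler_norml => /andP[? ?] /andP[? ?]; lra.
exists v, g; split => //.
by apply: aeW => s _; exact: g_cvg.
Qed.

End bochner_theory.

(** * The adjoint of the embedding and the covariance formula *)

Section adjoint.
Context {R : realType} {E H : completeNormedModType R}.
Variables (ip : {dot H for idfun}) (hip : induces_norm ip).
Variables (i : {linear H -> E}) (hi_cont : continuous i).

Lemma linear_bound (V W : normedModType R) (f : {linear V -> W}) :
  continuous f -> exists2 C, 0 <= C & forall x, `|f x| <= C * `|x|.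
Proof.
move=> /linear_bounded_continuous/linear_boundedP/pinfty_ex_gt0[C C0 fC].
by exists C => //; exact: ltW.
Qed.

Lemma dual_comp (V W : normedModType R) (phi : W -> R) (f : {linear V -> W}) :
  dual phi -> continuous f -> dual (phi \o f).
Proof.
move=> dphi /linear_bound[C C0 fC]; split=> [a x y|].
  by rewrite /= linearP dphi.1.
have [D D0 phiD] := dual_bound dphi.
exists (D * C) => x; rewrite (le_trans (phiD _))// -mulrA.
by rewrite ler_wpM2l.
Qed.

(** By the Riesz theorem the set in the definition of istar is not empty. *)
Lemma istarP phi : dual phi -> forall h, ip (istar ip i phi) h = phi (i h).
Proof.
move=> dphi; have dphii := dual_comp dphi hi_cont.
have [C _ phiC] := dual_bound dphii.
have [k kP] := @riesz_on_range R H ip hip H setT id (phi \o i) C Logic.I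
  (fun _ _ _ _ _ => Logic.I) (fun _ _ _ _ _ => erefl)
  (fun a u v _ _ => etrans (dualD _ _ dphii) (congr1 _ (dualZ _ _ dphii)))
  (fun v _ => phiC v).
by apply: (getPex (P := [set h | forall g, ip h g = phi (i g)])); exists k => g; exact: kP.
Qed.

Lemma ip_inj (u v : H) : (forall w, ip u w = ip v w) -> u = v.
Proof.
move=> uv; apply/subr0_eq/normr0_eq0/eqP; rewrite -sqrf_eq0 -hip.
rewrite -{1}scaleN1r ipDl uv; apply/eqP; ring.
Qed.

Lemma istar_lincomb phi psi a : dual phi -> dual psi ->
  istar ip i (fun x => phi x + a * psi x) = istar ip i phi + a *: istar ip i psi.
Proof.
move=> dphi dpsi; apply: ip_inj => w.
by rewrite ipDl !istarP//; exact: dual_lincomb.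
Qed.

(** Apply the bound to h = istar phi itself. *)
Lemma norm_istar_le phi K : dual phi -> 0 <= K ->
  (forall h, `|phi (i h)| <= K * `|h|) -> `|istar ip i phi| <= K.
Proof.
move=> dphi K0 phiK; set k := istar ip i phi.
have [->//|k0] := eqVneq `|k| 0.
have : `|k| * `|k| <= K * `|k|.
  by rewrite -expr2 -hip istarP// (le_trans (ler_norm _)).
by rewrite ler_pM2r// lt_def k0 normr_ge0.
Qed.

End adjoint.

Section covariance_formula.
Context {R : realType} {E H : completeNormedModType R}.
Variables (ip : {dot H for idfun}) (hip : induces_norm ip).
Variables (i : {linear H -> E}) (hi_cont : continuous i).
Variables (S : R -> {linear E -> E}) (hS : C0_semigroup S).
Hypothesis hE : separable E.

Local Notation g phi s := (istar ip i (phi \o S s)).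
Local Notation leb := (@lebesgue_measure R).

Lemma dual_semigroup (phi : E -> R) (s : R) : dual phi -> 0 <= s -> dual (phi \o S s).
Proof. by move=> dphi s0; apply: dual_comp => //; exact: C0_bounded. Qed.

Lemma istar_semigroup_bound (t : R) (phi : E -> R) : dual phi ->
  exists2 C, 0 <= C & forall s, 0 <= s -> s <= t -> `|g phi s| <= C.
Proof.
move=> dphi; have [C C0 SC] := C0_locally_bounded hS t.
have [D D0 phiD] := dual_bound dphi; have [B B0 iB] := linear_bound hi_cont.
exists (D * (C * B)) => [|s s0 st]; first by rewrite !mulr_ge0.
apply: norm_istar_le => // [||h]; first exact: dual_semigroup.
  by rewrite !mulr_ge0.
rewrite -!mulrA (le_trans (phiD _))// ler_wpM2l// (le_trans (SC _ s0 st _))//.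
by rewrite ler_wpM2l.
Qed.

(** The norm of istar (phi o S s) is the supremum over the unit ball of H of the
    functions s |-> phi (S s (i h)), which are continuous: it is lower
    semicontinuous, whatever the size of that ball. *)
Lemma measurable_norm_istar (t : R) (phi : E -> R) : dual phi ->
  measurable_fun `[0, t] (fun s => `|g phi s| : R).
Proof.
move=> dphi; pose G (s : R) := `|g phi (Num.max 0 s)|.
have max0 (s : R) : 0 <= Num.max 0 s by rewrite le_max lexx.
apply: (eq_measurable_fun G) => [s /set_mem /=|].
  by rewrite in_itv/= => /andP[s0 _]; rewrite /G max_r.
apply: measurable_funTS; apply/measurable_EFinP.
apply: lower_semicontinuous_measurable => s c; rewrite lte_fin => cG.
have [h [h1 hc]] : exists h : H, `|h| <= 1 /\ c < phi (S (Num.max 0 s) (i h)).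
  have dphis := dual_semigroup dphi (max0 s).
  rewrite /G in cG; set k := istar _ _ _ in cG.
  have [k0|k0] := eqVneq `|k| 0.
    by exists 0; rewrite normr0 !linear0 dual0// -[X in c < X]k0.
  exists (`|k|^-1 *: k); rewrite normrZ normfV normr_id mulVf//; split => //.
  rewrite -[phi _]/((phi \o S (Num.max 0 s)) _) -(istarP hip hi_cont dphis) -/k.
  by rewrite linearZr_LR/= hip expr2 mulKf.
exists [set r | c < phi (S (Num.max 0 r) (i h))].
  have cphi : {for s, continuous (fun r : R => phi (S (Num.max 0 r) (i h)) : R)}.
    apply: (@continuous_comp _ _ _ (fun r : R => S (Num.max 0 r) (i h)) phi).
      exact: C0_orbit_continuous.
    exact: dual_continuous.
  exact: (cvgr_gt _ cphi).
move=> r /= cr; rewrite lte_fin (lt_le_trans cr)// /G.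
have dphir := dual_semigroup dphi (max0 r).
rewrite -[phi _]/((phi \o S (Num.max 0 r)) _) -(istarP hip hi_cont dphir).
rewrite (le_trans (ler_norm _))// (le_trans (ip_cauchy_schwarz hip _ _))//.
by rewrite ler_piMr.
Qed.

(** By polarisation. *)
Lemma measurable_ip_istar (t : R) (phi psi : E -> R) : dual phi -> dual psi ->
  measurable_fun `[0, t] (fun s => ip (g psi s) (g phi s) : R).
Proof.
move=> dphi dpsi.
have dlc a : dual (fun x => psi x + a * phi x) by exact: dual_lincomb.
apply: (eq_measurable_fun (fun s =>
    4^-1 * (`|g (fun x => psi x + 1 * phi x) s| ^+ 2 -
            `|g (fun x => psi x + -1 * phi x) s| ^+ 2))) => [s /set_mem /=|].
  rewrite in_itv/= => /andP[s0 _].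
  have lc a : g (fun x => psi x + a * phi x) s = g psi s + a *: g phi s.
    by rewrite -(istar_lincomb hip hi_cont)//; exact: dual_semigroup.
  by rewrite !lc !(sqr_normD hip); field.
by apply: measurable_funM => //; apply: measurable_funB;
  apply: measurable_funX; exact: measurable_norm_istar.
Qed.

Lemma integrable_ip_istar (t : R) (phi psi : E -> R) : dual phi -> dual psi ->
  leb.-integrable `[0, t] (EFin \o (fun s => ip (g psi s) (g phi s) : R)).
Proof.
move=> dphi dpsi.
have [C C0 phiC] := istar_semigroup_bound t dphi.
have [D D0 psiD] := istar_semigroup_bound t dpsi.
have finm : (leb `[0%R, t] < +oo)%E.
  by rewrite lebesgue_measure_itv/=; case: ifP => _; rewrite ?ltry.
have mI : measurable (`[0, t]%classic : set (measurableTypeR R)) by [].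
apply: (bounded_integrable mI finm (M := D * C)).
- exact: measurable_ip_istar.
- move=> s; rewrite /= in_itv/= => /andP[s0 st].
  by rewrite (le_trans (ip_cauchy_schwarz hip _ _))// ler_pM ?phiC ?psiD.
Qed.

(** The integrand of Qt is only weakly measurable a priori, through the previous
    lemmas; separability of E makes it Bochner integrable. *)
Lemma dual_Qt (t : R) (phi psi : E -> R) : dual phi -> dual psi ->
  psi (Qt ip i S t phi) =
  \int[leb]_(s in `[0, t]) ip (g psi s) (g phi s).
Proof.
move=> dphi dpsi.
pose f s := S s (Qop ip i (phi \o S s)).
have fE psi' s : dual psi' -> 0 <= s -> psi' (f s) = ip (g psi' s) (g phi s).
  by move=> dpsi' s0; rewrite istarP//; exact: dual_semigroup.
have finm : (leb `[0%R, t] < +oo)%E.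
  by rewrite lebesgue_measure_itv/=; case: ifP => _; rewrite ?ltry.
have mf psi' : dual psi' -> measurable_fun `[0, t] (psi' \o f).
  move=> dpsi'; apply: (eq_measurable_fun (fun s => ip (g psi' s) (g phi s) : R));
    last exact: measurable_ip_istar.
  by move=> s /set_mem/=; rewrite in_itv/= => /andP[s0 _]; rewrite fE.
have [C C0 SC] := C0_locally_bounded hS t.
have [B B0 iB] := linear_bound hi_cont.
have [D D0 phiD] := istar_semigroup_bound t dphi.
have fM s : `[0, t]%classic s -> `|f s| <= C * (B * D).
  rewrite /= in_itv/= => /andP[s0 st].
  rewrite (le_trans (SC _ s0 st _))// ler_wpM2l// (le_trans (iB _))//.
  by rewrite ler_wpM2l// phiD.
have mI : measurable (`[0, t]%classic : set (measurableTypeR R)) by [].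
have [v fv] := bochner_integral_exists mI finm hE mf fM.
have -> := dual_bochner_integral mI finm hE mf fM dpsi (getPex (ex_intro _ v fv)).
apply: eq_Rintegral => s /set_mem/=; rewrite in_itv/= => /andP[s0 _].
by rewrite fE.
Qed.

End covariance_formula.

(** * Normal laws on the line *)

Lemma nbhs_infty_ger_succ {R : realType} (x : R) :
  \forall k \near \oo, `|x| <= k.+1%:R.
Proof.
near=> k; rewrite (@le_trans _ _ k%:R)// ?ler_nat//.
by near: k; exact: nbhs_infty_ger.
Unshelve. all: by end_near. Qed.

Section normal_integral.
Context {R : realType}.
Variable s : R.
Hypothesis s0 : 0 < s.
Local Notation leb := (@lebesgue_measure R).
Local Notation n := (normal_pdf 0 s).

Lemma normal_pdf0E x : n x = normal_peak s * expR (- (x ^+ 2 / (2 * s ^+ 2))).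
Proof.
rewrite normal_pdfE ?gt_eqF// /normal_fun subr0 mulNr.
by rewrite -(mulr_natl (s ^+ 2)).
Qed.

Let leb_dominates : normal_prob 0 s `<< leb.
Proof. exact: normal_prob_dominates. Qed.

Let measurable_pdf : measurable_fun [set: R] (EFin \o n).
Proof. by apply/measurable_EFinP; exact: measurable_normal_pdf. Qed.

(** By uniqueness of densities. *)
Let density_ae : ae_eq leb [set: R]
  (Radon_Nikodym_SigmaFinite.f (normal_prob 0 s) leb) (EFin \o n).
Proof.
apply: integral_ae_eq => //.
  exact: Radon_Nikodym_SigmaFinite.f_integrable.
by move=> A _ mA; rewrite -Radon_Nikodym_SigmaFinite.f_integral.
Qed.

Let density_charge_ae : ae_eq leb [set: R]
  (Radon_Nikodym (charge_of_finite_measure (normal_prob 0 s)) leb) (EFin \o n).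
Proof.
apply: integral_ae_eq => //; first exact: Radon_Nikodym_integrable.
by move=> A _ mA; rewrite -Radon_Nikodym_integral.
Qed.

(** Change of variables for the density of the normal law, which reduces to the
    Radon-Nikodym derivative up to a null set. *)
Lemma integral_normal_prob (f : R -> R) : measurable_fun [set: R] f ->
  leb.-integrable [set: R] (EFin \o (fun x => f x * n x)) ->
  (normal_prob 0 s).-integrable [set: R] (EFin \o f) /\
  \int[normal_prob 0 s]_x f x = \int[leb]_x (f x * n x).
Proof.
move=> mf ifn.
have mfE : measurable_fun [set: R] (EFin \o f) by exact/measurable_EFinP.
have mf1 : measurable_fun [set: R] (fun x => `|(f x)%:E|%E).
  exact: measurableT_comp.
have mRN : measurable_fun [set: R] (Radon_Nikodym_SigmaFinite.f (normal_prob 0 s) leb).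
  by have /integrableP[] := Radon_Nikodym_SigmaFinite.f_integrable leb_dominates.
have mRN' : measurable_fun [set: R]
    (Radon_Nikodym (charge_of_finite_measure (normal_prob 0 s)) leb).
  have : leb.-integrable [set: R]
      (Radon_Nikodym (charge_of_finite_measure (normal_prob 0 s)) leb).
    exact: Radon_Nikodym_integrable.
  by move=> /integrableP[].
have fE : (normal_prob 0 s).-integrable [set: R] (EFin \o f).
  apply/integrableP; split => //.
  rewrite -(Radon_Nikodym_SigmaFinite.change_of_variables leb_dominates)//.
  have -> : (\int[leb]_x (`|(f x)%:E| *
        Radon_Nikodym_SigmaFinite.f (normal_prob 0 s) leb x) =
      \int[leb]_x (`|(f x)%:E| * (n x)%:E))%E.
    apply: ae_eq_integral => //; [exact: emeasurable_funM..|].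
    exact: ae_eqe_mul2l.
  have /integrableP[_] := ifn; congr (_ < _)%E; apply: eq_integral => x _ /=.
  by rewrite normrM (ger0_norm (normal_pdf_ge0 _ _ _)).
split => //; rewrite /Rintegral; congr fine.
rewrite -(Radon_Nikodym_change_of_variables leb_dominates)//.
apply: ae_eq_integral => //.
- exact: emeasurable_funM.
- by have /integrableP[] := ifn.
- by apply: filterS density_charge_ae => x /= h _; rewrite h.
Qed.

(** The factor 1 + x ^ 2 is absorbed by three quarters of the exponent, since
    1 + y <= exp y for y = 3 x ^ 2 / (8 s ^ 2); what remains is the density of
    variance 4 s ^ 2. *)
Let normal_tail x : (1 + x ^+ 2) * n x <=
  (normal_peak s * (1 + 8 * s ^+ 2 / 3)) * expR (- (x ^+ 2 / (8 * s ^+ 2))).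
Proof.
rewrite normal_pdf0E mulrCA -mulrA ler_wpM2l ?normal_peak_ge0//.
have -> : - (x ^+ 2 / (2 * s ^+ 2)) =
    - (3 * x ^+ 2 / (8 * s ^+ 2)) - (x ^+ 2 / (8 * s ^+ 2)).
  by field; rewrite gt_eqF.
rewrite expRD mulrA ler_wpM2r ?expR_ge0// expRN.
rewrite -ler_pdivlMr ?invr_gt0 ?expR_gt0// invrK.
have := expR_ge1Dx (3 * x ^+ 2 / (8 * s ^+ 2)).
set e := expR _; set y := _ / _ => ye.
have y0 : 0 <= y by rewrite /y divr_ge0// mulr_ge0// sqr_ge0.
have -> : x ^+ 2 = (8 * s ^+ 2 / 3) * y by rewrite /y; field; rewrite gt_eqF.
have : 0 <= 8 * s ^+ 2 / 3 by rewrite divr_ge0// mulr_ge0// sqr_ge0.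
move: (8 * s ^+ 2 / 3) => K K0.
have : K * (1 + y) <= K * e by rewrite ler_wpM2l.
by lra.
Qed.

Lemma normal_dominated_integrable (w : R -> R) A : measurable_fun [set: R] w ->
  (forall x, `|w x| <= A * (1 + x ^+ 2)) ->
  leb.-integrable [set: R] (EFin \o (fun x => w x * n x)).
Proof.
move=> mw wA; have A0 : 0 <= A.
  by have := wA 0; rewrite expr0n addr0 mulr1; exact: le_trans.
have s20 : 0 < 2 * s by rewrite mulr_gt0.
(* normal_tail, restated with the density of standard deviation 2 s. *)
pose K := A * (normal_peak s * (1 + 8 * s ^+ 2 / 3)) / normal_peak (2 * s).
have in2 : leb.-integrable [set: R] (EFin \o (fun x => K * normal_pdf 0 (2 * s) x)).
  exact: (integrableZl measurableT K (integrable_normal_pdf 0 (2 * s))).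
apply: (le_integrable measurableT _ _ in2).
  apply/measurable_EFinP; apply: measurable_funM => //.
  exact: measurable_normal_pdf.
move=> x _ /=; rewrite lee_fin normrM (ger0_norm (normal_pdf_ge0 _ _ _)).
rewrite (le_trans _ (ler_norm _))//.
rewrite (le_trans (ler_wpM2r (normal_pdf_ge0 _ _ _) (wA x)))//.
rewrite -mulrA /K (@normal_pdfE _ 0 (2 * s)) ?gt_eqF// /normal_fun subr0.
have -> : - x ^+ 2 / ((2 * s) ^+ 2 *+ 2) = - (x ^+ 2 / (8 * s ^+ 2)).
  by rewrite mulNr; congr (- (_ / _)); rewrite -mulr_natl; ring.
rewrite -!mulrA ler_wpM2l// mulKf ?gt_eqF ?normal_peak_gt0// ?gt_eqF//.
by have := normal_tail x; rewrite !mulrA.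
Qed.

Let normal_deriv x : is_derive x (1 : R) n (- (x / s ^+ 2) * n x).
Proof.
rewrite (funext normal_pdf0E).
apply: is_derive_eq.
rewrite /GRing.scale/=.
by set e := expR _; field; rewrite gt_eqF.
Qed.

(** The function u n has derivative u' n - x u n / s ^ 2 and vanishes at infinity;
    integrate over [- N, N] and let N tend to infinity. *)
Lemma normal_integration_by_parts (u du : R -> R) A :
  (forall x, is_derive x (1 : R) u (du x)) -> continuous du ->
  (forall x, `|u x| <= A * (1 + `|x|)) -> (forall x, `|du x| <= A) ->
  \int[normal_prob 0 s]_x (x * u x) = s ^+ 2 * \int[normal_prob 0 s]_x du x.
Proof.
move=> du_u cdu uA duA.
have A0 : 0 <= A by rewrite (le_trans _ (duA 0)).
have cu : continuous u.
  by move=> x; apply: differentiable_continuous; apply/derivable1_diffP; exact: ex_derive.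
have cn : continuous n by apply: continuous_normal_pdf; rewrite gt_eqF.
have mu_ : measurable_fun [set: R] u by exact: continuous_measurable_fun.
have mdu : measurable_fun [set: R] du by exact: continuous_measurable_fun.
have mxu : measurable_fun [set: R] (fun x => x * u x) by exact: measurable_funM.
have idu : leb.-integrable [set: R] (EFin \o (fun x => du x * n x)).
  apply: (@normal_dominated_integrable _ A) => // x.
  by rewrite (le_trans (duA x))// ler_peMr// lerDl sqr_ge0.
have ixu : leb.-integrable [set: R] (EFin \o (fun x => (x * u x) * n x)).
  apply: (@normal_dominated_integrable _ (2 * A)) => // x.
  rewrite normrM (le_trans (ler_wpM2l (normr_ge0 x) (uA x)))//.
  rewrite -real_normK ?num_real//.
  have := sqr_ge0 (`|x| - 1); have := normr_ge0 x; nra.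
have [_ ->] := integral_normal_prob mdu idu.
have [_ ->] := integral_normal_prob mxu ixu.
pose h x := du x * n x - s ^- 2 * ((x * u x) * n x).
have ixu' : leb.-integrable [set: R] (EFin \o (fun x => s ^- 2 * ((x * u x) * n x))).
  exact: (integrableZl measurableT (s ^- 2) ixu).
have ih : leb.-integrable [set: R] (EFin \o h).
  exact: (integrableB measurableT idu ixu').
suff : \int[leb]_x h x = 0.
  rewrite RintegralB// RintegralZl// => /eqP; rewrite subr_eq0 => /eqP ->.
  by rewrite mulVKf// expf_neq0// gt_eqF.
have dF x : is_derive x (1 : R) (fun x => u x * n x) (h x).
  have dux := du_u x; have dnx := normal_deriv x.
  apply: is_derive_eq; rewrite /GRing.scale/= /h.
  by move: (u x) (n x) (du x) => ux nx dux'; field; rewrite gt_eqF.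
have cF : continuous (fun x => u x * n x) by move=> x; apply: cvgM; [exact: cu|exact: cn].
have ch : continuous h.
  move=> x; apply: cvgB; first by apply: cvgM; [exact: cdu|exact: cn].
  apply: cvgM; first exact: cvg_cst.
  by apply: cvgM; [apply: cvgM; [exact: cvg_id|exact: cu]|exact: cn].
pose I (k : nat) := \int[leb]_(x in `[- k.+1%:R, k.+1%:R]) h x.
have IE k : I k = u k.+1%:R * n k.+1%:R - u (- k.+1%:R) * n (- k.+1%:R).
  have := @continuous_FTC2 R h (fun x => u x * n x) (- k.+1%:R) k.+1%:R.
  rewrite /I /Rintegral => ->//.
  - by rewrite gtrN// ltr0n.
  - exact: continuous_subspaceT.
  - by split=> [x _||]; [exact: ex_derive|apply: cvg_at_right_filter; exact: cF|
      apply: cvg_at_left_filter; exact: cF].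
  - by move=> x _; rewrite derive1E; exact: derive_val.
pose C := normal_peak s * (1 + 8 * s ^+ 2 / 3).
have Fbound x : `|x| * `|u x * n x| <= 2 * A * C.
  have nC : (1 + x ^+ 2) * n x <= C.
    rewrite (le_trans (normal_tail x))// ler_piMr//.
      rewrite mulr_ge0 ?normal_peak_ge0// addr_ge0// divr_ge0// mulr_ge0//.
      exact: sqr_ge0.
    by rewrite expR_le1// oppr_le0 divr_ge0 ?sqr_ge0// mulr_ge0// sqr_ge0.
  have n0 := normal_pdf_ge0 0 s x.
  rewrite normrM (ger0_norm n0) mulrA.
  apply: (@le_trans _ _ ((2 * A) * ((1 + x ^+ 2) * n x))); last first.
    by rewrite ler_wpM2l// mulr_ge0.
  rewrite mulrA ler_wpM2r//.
  rewrite (le_trans (ler_wpM2l (normr_ge0 x) (uA x)))//.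
  rewrite -(real_normK (num_real x)).
  have := sqr_ge0 (`|x| - 1); have := normr_ge0 x; move: (`|x|) => y.
  by rewrite mulrCA -mulrA [2 * _]mulrCA => y0 y1; rewrite ler_wpM2l//; nra.
have I0 : I k @[k --> \oo] --> 0.
  apply: (@cvg_dist_le _ R^o _ (fun k => (4 * A * C) * k.+1%:R^-1)) => [k|].
    rewrite sub0r normrN IE (le_trans (ler_normB _ _))//.
    have := Fbound k.+1%:R; have := Fbound (- k.+1%:R).
    rewrite normrN ger0_norm// -!(mulrC k.+1%:R^-1) ler_pdivlMl//.
    lra.
  by rewrite -(mulr0 (4 * A * C)); apply: cvgMr; exact: cvg_harmonic.
have Ih : I k @[k --> \oo] --> \int[leb]_x h x.
  pose D (k : nat) : set R := `[- k.+1%:R, k.+1%:R]%classic.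
  have mh : measurable_fun [set: R] h by exact: continuous_measurable_fun.
  have : (\int[leb]_x ((EFin \o h) \_ (D k)) x)%E @[k --> \oo] -->
      (\int[leb]_x (EFin \o h) x)%E.
    apply: (@dominated_cvg _ _ _ leb setT measurableT
      (fun k => (EFin \o h) \_ (D k)) (EFin \o h) (fun x => `|h x|%:E)).
    - move=> k; apply/(measurable_restrictT _ _).1; first exact: measurable_itv.
      by apply: measurable_funTS; apply/measurable_EFinP.
    - move=> x _; apply: cvg_near_cst; near=> k.
      rewrite patchE mem_set//= /D /= in_itv/= -ler_norml.
      near: k; exact: (nbhs_infty_ger_succ x).
    - by [].
    - exact: integrable_norm.
    - by move=> k x _; rewrite patchE; case: ifP => _; rewrite /= ?lexx ?normr0 ?lee_fin.
  have -> : (\int[leb]_x (EFin \o h) x)%E = (\int[leb]_x h x)%:E.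
    by rewrite /Rintegral fineK//; exact: integrable_fin_num ih.
  move=> /fine_cvg; rewrite /I /Rintegral; apply: cvg_trans.
  by apply: near_eq_cvg; apply: nearW => k /=; rewrite [in RHS]integral_mkcond.
exact: (cvg_unique _ Ih I0).
Unshelve. all: by end_near. Qed.

End normal_integral.

(** * Characteristic functions of Gaussian variables *)

Section calculus.
Context {R : realType}.

(** For differentiation under the integral sign: a pointwise quadratic bound on
    the integrand integrates to a second moment. *)
Lemma is_derive_quadratic (G : R -> R) (r l K : R) :
  (forall e, `|G (r + e) - G r - e * l| <= K * e ^+ 2) ->
  is_derive r (1 : R) G l.
Proof.
move=> GK.
have dG : (fun h : R => h^-1 *: (G (h *: (1 : R) + r) - G r)) @ 0^' --> l.
  apply/cvgrPdist_lt => e e0; near=> h.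
  have h0 : h != 0 by near: h; exact: nbhs_dnbhs_neq.
  have hK : `|h| * (`|K| + 1) < e.
    rewrite -ltr_pdivlMr ?ltr_wpDl//.
    near: h; apply: dnbhs0_lt; by rewrite divr_gt0// ltr_wpDl.
  have -> : l - h^-1 *: (G (h *: (1 : R) + r) - G r) =
      - (h^-1 * (G (r + h) - G r - h * l)).
    by rewrite /GRing.scale/= mulr1 (addrC h r); field.
  rewrite normrN normrM normfV (le_lt_trans _ hK)// ler_pdivrMl ?normr_gt0//.
  rewrite (le_trans (GK h))// -(real_normK (num_real h)) mulrC expr2 -mulrA.
  rewrite ler_wpM2l// ler_wpM2l// (le_trans (ler_norm _))// lerDl//.
apply: DeriveDef; first by apply/cvg_ex; exists l.
by apply/cvg_lim.
Unshelve. all: by end_near. Qed.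

Lemma mvt_bound (f df : R -> R) (K a b : R) :
  (forall x, is_derive x (1 : R) f (df x)) ->
  (forall x, `|x - a| <= `|b - a| -> `|df x| <= K) ->
  `|f b - f a| <= K * `|b - a|.
Proof.
move=> df_f dfK.
have cf : continuous f.
  by move=> x; apply: differentiable_continuous; apply/derivable1_diffP; exact: ex_derive.
have [ab|ba] := leP a b.
  have [c ci ->] := MVT_segment ab (fun x _ => df_f x) (continuous_subspaceT cf).
  rewrite normrM ler_wpM2r// dfK//; move: ci; rewrite in_itv/= => /andP[ac cb].
  by rewrite !ger0_norm ?subr_ge0// lerB.
have [c ci E] := MVT_segment (ltW ba) (fun x _ => df_f x) (continuous_subspaceT cf).
rewrite distrC E normrM (distrC a) ler_wpM2r// dfK//.
move: ci; rewrite in_itv/= => /andP[bc ca].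
by rewrite !ler0_norm ?subr_le0 ?(ltW ba)// !opprB lerB.
Qed.

Lemma sin_lipschitz (a b : R) : `|sin b - sin a| <= `|b - a|.
Proof.
rewrite -[leRHS]mul1r; apply: (@mvt_bound _ cos) => // x _.
by rewrite ler_norml cos_geN1 cos_le1.
Qed.

(** The derivative in e of the left-hand side is sin a - sin (a + e), at most |e|
    in absolute value. *)
Lemma cos_taylor (a e : R) : `|cos (a + e) - cos a + e * sin a| <= e ^+ 2.
Proof.
have ae : a + e - a = e by rewrite addrC addKr.
have := @mvt_bound (fun x => cos x + x * sin a) (fun x => - sin x + sin a) `|e| a (a + e).
rewrite ae -normrM -expr2 (ger0_norm (sqr_ge0 _)).
have -> : cos (a + e) + (a + e) * sin a - (cos a + a * sin a) =
  cos (a + e) - cos a + e * sin a by ring.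
apply=> [x|x xe].
  by apply: is_derive_eq; rewrite /GRing.scale/=; ring.
by rewrite addrC distrC (le_trans (sin_lipschitz _ _)).
Qed.

End calculus.

Section integral_law.
Context {d : measure_display} {T : measurableType d} {R : realType}.
Variables (P : {measure set T -> \bar R}) (X : T -> measurableTypeR R).
Hypothesis mX : measurable_fun [set: T] X.

(** Transfer of integrals to the law of X. *)
Lemma integral_law (nu : {measure set (measurableTypeR R) -> \bar R})
    (g : measurableTypeR R -> R) :
  (forall A, measurable A -> pushforward P X A = nu A) ->
  measurable_fun [set: measurableTypeR R] g -> nu.-integrable [set: measurableTypeR R] (EFin \o g) ->
  P.-integrable [set: T] (EFin \o (g \o X)) /\
  \int[P]_x g (X x) = \int[nu]_x g x.
Proof.
move=> PXnu mg /integrableP[_ ig].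
have mgE : measurable_fun [set: measurableTypeR R] (EFin \o g) by exact/measurable_EFinP.
have igX : P.-integrable [set: T] (EFin \o (g \o X)).
  apply/integrableP; split; first exact: (measurableT_comp mgE mX).
  have := @ge0_integral_pushforward _ _ _ _ _ _ mX P setT (fun x => `|(g x)%:E|%E) measurableT.
  rewrite preimage_setT => <-//; last exact: measurableT_comp.
  by rewrite (eq_measure_integral nu)// => A mA _; exact: PXnu.
split => //; rewrite /Rintegral; congr fine.
have := @integral_pushforward _ _ _ _ _ _ mX P setT (EFin \o g) mgE.
rewrite preimage_setT => <-//.
by apply: eq_measure_integral => A mA _; exact: PXnu.
Qed.

End integral_law.

Section cos_integral.
Context {d : measure_display} {T : measurableType d} {R : realType}.
Variable P : probability T R.
Implicit Types X Y Z : T -> R.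

Lemma prob_bounded_integrable X M : measurable_fun [set: T] X ->
  (forall x, `|X x| <= M) -> P.-integrable [set: T] (EFin \o X).
Proof.
move=> mX XM; apply: (bounded_integrable measurableT _ (M := M)) => //.
by rewrite (le_lt_trans (probability_le1 P measurableT))// ltry.
Qed.

Lemma prob_Rintegral_cst (c : R) : \int[P]_x (cst c) x = c.
Proof.
rewrite Rintegral_cst//; have -> : fine (P setT) = 1 by rewrite probability_setT.
by rewrite mulr1.
Qed.

Lemma measurable_cos_comp X : measurable_fun [set: T] X ->
  measurable_fun [set: T] (fun x => cos (X x)).
Proof.
by move=> mX; apply: measurableT_comp mX; apply: continuous_measurable_fun; exact: continuous_cos.
Qed.

Lemma measurable_sin_comp X : measurable_fun [set: T] X ->
  measurable_fun [set: T] (fun x => sin (X x)).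
Proof.
by move=> mX; apply: measurableT_comp mX; apply: continuous_measurable_fun; exact: continuous_sin.
Qed.

Lemma cos_integrable X : measurable_fun [set: T] X ->
  P.-integrable [set: T] (EFin \o (fun x => cos (X x))).
Proof.
move=> mX; apply: (@prob_bounded_integrable _ 1); first exact: measurable_cos_comp.
by move=> x; rewrite ler_norml cos_geN1 cos_le1.
Qed.

Lemma square_integrable_bounded_mul Y Z M : measurable_fun [set: T] Y ->
  measurable_fun [set: T] Z -> (forall x, `|Z x| <= M) ->
  P.-integrable [set: T] (EFin \o (fun x => Y x ^+ 2)) ->
  P.-integrable [set: T] (EFin \o (fun x => Y x * Z x)).
Proof.
move=> mY mZ ZM iY.
have i1 : P.-integrable [set: T] (EFin \o cst 1).
  by apply: (@prob_bounded_integrable _ 1) => // x; rewrite normr1.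
apply: (le_integrable measurableT _ _
    (integrableZl measurableT M (integrableD measurableT i1 iY))).
  by apply/measurable_EFinP; exact: measurable_funM.
move=> x _ /=; rewrite lee_fin normrM.
rewrite (le_trans (ler_wpM2l (normr_ge0 _) (ZM x)))//.
rewrite (le_trans _ (ler_norm _))// mulrC ler_wpM2l ?(le_trans _ (ZM x))//.
rewrite -(real_normK (num_real (Y x))).
by have := sqr_ge0 (`|Y x| - 1); have := normr_ge0 (Y x); nra.
Qed.

(** Integrate cos_taylor, with e Y in the role of the increment. *)
Lemma is_derive_integral_cos X Y (r : R) :
  measurable_fun [set: T] X -> measurable_fun [set: T] Y ->
  P.-integrable [set: T] (EFin \o (fun x => Y x ^+ 2)) ->
  is_derive r (1 : R) (fun r => \int[P]_x cos (X x + r * Y x))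
    (- \int[P]_x (Y x * sin (X x + r * Y x))).
Proof.
move=> mX mY iY.
have mXY s : measurable_fun [set: T] (fun x => X x + s * Y x).
  by apply: measurable_funD => //; exact: measurable_funM.
have icos s := cos_integrable (mXY s).
have isin : P.-integrable [set: T] (EFin \o (fun x => Y x * sin (X x + r * Y x))).
  apply: (@square_integrable_bounded_mul _ _ 1) => //; first exact: measurable_sin_comp.
  by move=> x; rewrite ler_norml sin_geN1 sin_le1.
apply: (@is_derive_quadratic _ _ _ _ (\int[P]_x (Y x ^+ 2))) => e.
have iesin : P.-integrable [set: T]
    (EFin \o (fun x => e * (Y x * sin (X x + r * Y x)))).
  exact: (integrableZl measurableT e isin).
have iB : P.-integrable [set: T]
    (EFin \o (fun x => cos (X x + (r + e) * Y x) - cos (X x + r * Y x))).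
  exact: (integrableB measurableT (icos _) (icos _)).
rewrite mulrN opprK -RintegralB// -RintegralZl// -RintegralD// mulrC -RintegralZl//.
have iBD : P.-integrable [set: T] (EFin \o (fun x =>
    cos (X x + (r + e) * Y x) - cos (X x + r * Y x) +
    e * (Y x * sin (X x + r * Y x)))).
  exact: (integrableD measurableT iB iesin).
rewrite (le_trans (le_normr_Rintegral measurableT iBD))//.
apply: le_Rintegral => //.
- exact: (integrable_norm iBD).
- exact: (integrableZl measurableT (e ^+ 2) iY).
- move=> x _; rewrite mulrDl addrA mulrA -exprMn.
  exact: cos_taylor.
Qed.

End cos_integral.

Lemma normal_second_moment {R : realType} (s : R) : 0 < s ->
  (normal_prob 0 s).-integrable [set: R] (EFin \o (fun x => x ^+ 2)) /\
  \int[normal_prob 0 s]_x (x ^+ 2) = s ^+ 2.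
Proof.
move=> s0.
have mx2 : measurable_fun [set: R] (fun x : R => x ^+ 2) by exact: measurable_funX.
have [|ix2 _] := @integral_normal_prob _ s _ mx2.
  apply: (@normal_dominated_integrable _ _ s0 _ 1) => // x.
  by rewrite mul1r ger0_norm ?sqr_ge0// lerDr.
split => //.
have := @normal_integration_by_parts _ _ s0 id (cst 1) 1.
have -> : (fun x : R => x * id x) = (fun x => x ^+ 2) by apply/funext => x; rewrite expr2.
move=> ->.
- by rewrite (prob_Rintegral_cst (normal_prob 0 s)) mulr1.
- by move=> x; exact: cvg_cst.
- by move=> x; rewrite mul1r lerDr.
- by move=> x; rewrite /= normr1.
Qed.

(** The integral G r of cos (c + r x) satisfies G' = - s ^ 2 r G by
    normal_integration_by_parts, so G r * exp (s ^ 2 r ^ 2 / 2) is constant. *)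
Lemma normal_cos {R : realType} (s c : R) : 0 < s ->
  \int[normal_prob 0 s]_x cos (x + c) = cos c * expR (- (s ^+ 2 / 2)).
Proof.
move=> s0.
pose G r := \int[normal_prob 0 s]_x cos (c + r * x).
have [ix2 _] := normal_second_moment s0.
have dG r : is_derive r (1 : R) G (- s ^+ 2 * r * G r).
  have := @is_derive_integral_cos _ _ _ (normal_prob 0 s) (cst c) id r.
  move=> /(_ (@measurable_cst _ _ _ _ _ _) (@measurable_id _ _ _) ix2).
  suff -> : \int[normal_prob 0 s]_x (id x * sin (c + r * id x)) =
      s ^+ 2 * (r * G r) by rewrite -mulNr mulrA.
  have dsin x : is_derive x (1 : R) (fun x => sin (c + r * x)) (r * cos (c + r * x)).
    by apply: is_derive_eq; rewrite /GRing.scale/=; ring.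
  rewrite (@normal_integration_by_parts _ _ s0 (fun x => sin (c + r * x))
    (fun x => r * cos (c + r * x)) (1 + `|r|)).
  - rewrite RintegralZl//; apply: cos_integrable.
    by apply: measurable_funD => //; exact: measurable_funM.
  - move=> x; apply: cvgM; first exact: cvg_cst.
    apply: (cvg_comp (fun x => c + r * x) cos); last exact: continuous_cos.
    by apply: cvgD; [exact: cvg_cst|apply: cvgM; [exact: cvg_cst|exact: cvg_id]].
  - move=> x; rewrite (@le_trans _ _ 1)//; first by rewrite ler_norml sin_geN1 sin_le1.
    by have := normr_ge0 r; have := normr_ge0 x; nra.
  - move=> x; rewrite normrM (@le_trans _ _ (`|r| * 1))//.
      by rewrite ler_wpM2l// ler_norml cos_geN1 cos_le1.
    by rewrite mulr1 lerDr.
pose K r := G r * expR (s ^+ 2 * r ^+ 2 / 2).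
have dK r : is_derive r (1 : R) K 0.
  have dGr := dG r.
  by apply: is_derive_eq; rewrite /GRing.scale/=; field.
have := is_derive_0_is_cst 1 0 dK.
rewrite /K expr0n/= mulr0 mul0r expR0 mulr1 expr1n mulr1 /G.
have -> : \int[normal_prob 0 s]_x cos (c + 0 * x) = cos c.
  under eq_Rintegral do rewrite mul0r addr0.
  exact: (prob_Rintegral_cst (normal_prob 0 s)).
move=> <-; rewrite -mulrA -expRD subrr expR0 mulr1.
by apply: eq_Rintegral => x _; rewrite mul1r addrC.
Qed.

Lemma dirac_Rintegral d (T : measurableType d) (R : realType) (a : T) (g : T -> R) :
  measurable_fun [set: T] g ->
  (\d_a : {measure set T -> \bar R}).-integrable [set: T] (EFin \o g) /\
  \int[(\d_a : {measure set T -> \bar R})]_x g x = g a.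
Proof.
move=> mg; have mgE : measurable_fun [set: T] (EFin \o g) by exact/measurable_EFinP.
split; last by rewrite /Rintegral integral_dirac// diracT mul1e.
apply/integrableP; split => //.
rewrite integral_dirac//; last exact: measurableT_comp.
by rewrite diracT mul1e /= ltry.
Qed.

Section gaussian_variable.
Context {d : measure_display} {T : measurableType d} {R : realType}.
Variables (P : probability T R) (X : T -> measurableTypeR R).
Hypotheses (mX : measurable_fun [set: T] X)
  (gX : centred_gaussian_law (pushforward P X)).

Lemma gaussian_square_integrable :
  P.-integrable [set: T] (EFin \o (fun x => (X x : R) ^+ 2)).
Proof.
have mx2 : measurable_fun [set: measurableTypeR R] (fun x : measurableTypeR R => x ^+ 2 : R).
  exact: (@measurable_funX _ _ R).
have [g0|[s s0 gs]] := gX.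
  have [ix2 _] := dirac_Rintegral ((0 : R) : measurableTypeR R) mx2.
  by have [] := @integral_law _ _ _ P X mX (\d_((0 : R) : measurableTypeR R)) _ g0 mx2 ix2.
have [ix2 _] := normal_second_moment s0.
by have [] := @integral_law _ _ _ P X mX (normal_prob 0 s) _ gs mx2 ix2.
Qed.

(** Degenerate laws are included, with vanishing second moment. *)
Lemma gaussian_cos c : \int[P]_x cos ((X x : R) + c) =
  cos c * expR (- (\int[P]_x ((X x : R) ^+ 2) / 2)).
Proof.
have mx2 : measurable_fun [set: measurableTypeR R] (fun x : measurableTypeR R => x ^+ 2 : R).
  exact: (@measurable_funX _ _ R).
have mcos : measurable_fun [set: measurableTypeR R] (fun x : measurableTypeR R => cos ((x : R) + c) : R).
  by apply: measurable_cos_comp; exact: measurable_funD.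
have [g0|[s s0 gs]] := gX.
  have [ix2 Ex2] := dirac_Rintegral ((0 : R) : measurableTypeR R) mx2.
  have [_ ->] := @integral_law _ _ _ P X mX (\d_((0 : R) : measurableTypeR R)) _ g0 mx2 ix2.
  have [icos Ecos] := dirac_Rintegral ((0 : R) : measurableTypeR R) mcos.
  have [_ ->] := @integral_law _ _ _ P X mX (\d_((0 : R) : measurableTypeR R)) _ g0 mcos icos.
  by rewrite Ex2 Ecos add0r expr0n/= mul0r oppr0 expR0 mulr1.
have [ix2 Ex2] := normal_second_moment s0.
have [_ ->] := @integral_law _ _ _ P X mX (normal_prob 0 s) _ gs mx2 ix2.
have icos : (normal_prob 0 s).-integrable [set: measurableTypeR R]
    (EFin \o (fun x : measurableTypeR R => cos ((x : R) + c))).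
  by apply: cos_integrable; exact: measurable_funD.
have [_ ->] := @integral_law _ _ _ P X mX (normal_prob 0 s) _ gs mcos icos.
by rewrite normal_cos// Ex2.
Qed.

End gaussian_variable.

(** * Approximation of Borel functions by trigonometric polynomials *)

Section threshold.
Context {R : realType}.

Lemma bernoulli_ineq (u : R) m : -1 <= u -> 1 + m%:R * u <= (1 + u) ^+ m.
Proof.
move=> u1; elim: m => [|m IH]; first by rewrite mul0r addr0 expr0.
rewrite exprS -natr1 (le_trans _ (ler_wpM2l _ IH))//; last by lra.
have : 0 <= m%:R * u ^+ 2 :> R by rewrite mulr_ge0// sqr_ge0.
by move: (m%:R : R) => k; nra.
Qed.

(** Polynomials that map [0, 1] to itself and converge to 1 below 1/2 and to 0 from
    1/2 on. The factor 2 ^ n in the exponent places the jump at 1/2, the further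
    factor n forces the limit 0 at the jump itself. *)
Definition threshold n (x : R) := (1 - x ^+ n) ^+ (2 ^ n * n).

(** Since (1 - y) (1 + y) <= 1 and, for y = x ^ n, (1 + y) ^ (2 ^ n) is at least
    1 + (2 x) ^ n >= 2. *)
Lemma threshold_ge x n : 1 / 2 <= x -> x <= 1 -> threshold n x <= 2^-1 ^+ n.
Proof.
move=> x2 x1; have x0 : 0 <= x by lra.
have xn0 : 0 <= x ^+ n by exact: exprn_ge0.
have xn1 : x ^+ n <= 1 by exact: exprn_ile1.
rewrite /threshold exprM; apply: lerXn2r; rewrite ?nnegrE ?exprn_ge0 ?subr_ge0//.
have h : 2 <= (1 + x ^+ n) ^+ (2 ^ n)%N.
  apply: (le_trans _ (bernoulli_ineq _ _)); last by lra.
  rewrite natrX -exprMn -[leLHS]/(1 + 1) lerD2l.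
  by apply: exprn_ege1; lra.
have : (1 - x ^+ n) ^+ (2 ^ n)%N * (1 + x ^+ n) ^+ (2 ^ n)%N <= 1.
  rewrite -exprMn; apply: exprn_ile1; nra.
have : 0 <= (1 - x ^+ n) ^+ (2 ^ n)%N by rewrite exprn_ge0// subr_ge0.
by move: h; move: (_ ^+ (2 ^ n)%N) (_ ^+ (2 ^ n)%N) => a b; nra.
Qed.

Lemma threshold_01 x n : 0 <= x -> x <= 1 -> 0 <= threshold n x <= 1.
Proof.
move=> x0 x1; have xn0 : 0 <= x ^+ n by exact: exprn_ge0.
have xn1 : x ^+ n <= 1 by exact: exprn_ile1.
rewrite /threshold exprn_ge0 ?subr_ge0//=.
by apply: exprn_ile1; rewrite ?subr_ge0// lerBlDr lerDl.
Qed.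

(** Bernoulli's inequality gives the lower bound 1 - n (2 x) ^ n. With q ^ 2 = 2 x,
    one factor q ^ n keeps n q ^ n bounded and the other tends to 0. *)
Lemma threshold_lt x : 0 <= x -> x < 1 / 2 -> threshold n x @[n --> \oo] --> (1 : R).
Proof.
move=> x0 x2.
pose r := 2 * x.
have r0 : 0 <= r by rewrite /r; lra.
have r1 : r < 1 by rewrite /r; lra.
pose q := Num.sqrt r.
have q0 : 0 <= q by exact: sqrtr_ge0.
have q1 : q < 1 by rewrite -sqrtr1 ltr_sqrt.
have qr : q ^+ 2 = r by exact: sqr_sqrtr.
have nq n : n%:R * q ^+ n <= (1 - q)^-1.
  suff : (n%:R * q ^+ n) * (1 - q) <= 1 - q ^+ n.
    rewrite -[(1 - q)^-1]mul1r ler_pdivlMr ?subr_gt0// => /le_trans; apply.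
    by rewrite lerBlDr lerDl exprn_ge0.
  elim: n => [|n IH]; first by rewrite mul0r mul0r expr0 subrr.
  rewrite exprS -natr1; have qn : 0 <= q ^+ n by exact: exprn_ge0.
  have qn1 : q ^+ n <= 1 by apply: exprn_ile1 => //; exact: ltW.
  move: IH qn qn1; move: (q ^+ n) (n%:R : R) => a k IH a0 a1.
  have : q * (k * a * (1 - q)) <= q * (1 - a) by rewrite ler_wpM2l.
  have : 0 <= (1 - q) * (1 - q * a) by rewrite mulr_ge0 ?subr_ge0 ?(ltW q1)// mulr_ile1// ltW.
  by lra.
apply: (@cvg_dist_le _ R^o _ (fun n => (1 - q)^-1 * q ^+ n)) => [n|].
  have x1 : x <= 1 by lra.
  have /andP[_ t1] := threshold_01 n x0 x1.
  rewrite ger0_norm ?subr_ge0// lerBlDr -lerBlDl.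
  have xn1 : x ^+ n <= 1 by exact: exprn_ile1.
  have := @bernoulli_ineq (- x ^+ n) (2 ^ n * n)%N.
  rewrite lerN2 => /(_ xn1); apply: le_trans.
  rewrite mulrN lerD2l lerN2 natrM natrX mulrAC -exprMn -/r -qr.
  rewrite -exprM mulnC exprM expr2 mulrC mulrA.
  by rewrite ler_wpM2r// exprn_ge0.
rewrite -(mulr0 (1 - q)^-1); apply: cvgMr.
by apply: cvg_expr; rewrite ger0_norm.
Qed.

Lemma cvg_threshold x : 0 <= x -> x <= 1 ->
  threshold n x @[n --> \oo] --> ((x < 1 / 2)%R%:R : R).
Proof.
move=> x0 x1; case: ltP => x2; first exact: threshold_lt.
apply: (@cvg_dist_le _ R^o _ (fun n => 2^-1 ^+ n)) => [n|].
  have /andP[t0 _] := threshold_01 n x0 x1.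
  by rewrite sub0r normrN ger0_norm// threshold_ge.
by apply: cvg_expr; rewrite ger0_norm; lra.
Qed.

End threshold.

Section trig_poly.
Context {R : realType} {E : completeNormedModType R}.

(** The phases c make this class an algebra without separate sines. *)
Inductive trig_poly : (E -> R) -> Prop :=
| trig_cos phi c : dual phi -> trig_poly (fun x => cos (phi x + c))
| trig_add p q : trig_poly p -> trig_poly q -> trig_poly (fun x => p x + q x)
| trig_scale a p : trig_poly p -> trig_poly (fun x => a * p x).

Lemma trig_cst a : trig_poly (fun=> a).
Proof.
have := trig_scale a (trig_cos 0 dual_zero).
by congr trig_poly; apply/funext => x; rewrite addr0 cos0 mulr1.
Qed.

Lemma trig_onem p : trig_poly p -> trig_poly (fun x => 1 - p x).
Proof.
move=> tp; have := trig_add (trig_cst 1) (trig_scale (-1) tp).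
by congr trig_poly; apply/funext => x; rewrite mulN1r.
Qed.

Lemma trig_mul p q : trig_poly p -> trig_poly q -> trig_poly (fun x => p x * q x).
Proof.
elim=> {p} [phi c dphi|p p' _ IHp _ IHp'|a p _ IHp] tq.
- elim: tq => {q} [psi e dpsi|q q' _ IHq _ IHq'|a q _ IHq].
  + have := trig_scale 2^-1 (trig_add
      (trig_cos (c + e) (dual_lincomb 1 dphi dpsi))
      (trig_cos (c - e) (dual_lincomb (-1) dphi dpsi))).
    congr trig_poly; apply/funext => x.
    rewrite mul1r mulN1r.
    have -> : phi x + psi x + (c + e) = (phi x + c) + (psi x + e) by ring.
    have -> : phi x - psi x + (c - e) = (phi x + c) - (psi x + e) by ring.
    by rewrite cosD cosB; field.
  + by have := trig_add IHq IHq'; congr trig_poly; apply/funext => x; rewrite mulrDr.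
  + by have := trig_scale a IHq; congr trig_poly; apply/funext => x; rewrite mulrCA.
- have := trig_add (IHp tq) (IHp' tq).
  by congr trig_poly; apply/funext => x; rewrite mulrDl.
- have := trig_scale a (IHp tq).
  by congr trig_poly; apply/funext => x; rewrite mulrA.
Qed.

Lemma trig_exp p n : trig_poly p -> trig_poly (fun x => p x ^+ n).
Proof.
move=> tp; elim: n => [|n IH]; first by have := trig_cst 1; congr trig_poly.
by have := trig_mul tp IH; congr trig_poly; apply/funext => x; rewrite exprS.
Qed.

Lemma continuous_measurable_borel (f : E -> R) :
  continuous f -> measurable_fun [set: borel_type E] (f : borel_type E -> R).
Proof.
move=> cf; apply: (measurability _ (RGenOInfty.measurableE R)).
move=> _ [_ [a ->] <-]; rewrite setTI; apply: sub_sigma_algebra.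
by apply: open_comp => // x _; exact: cf.
Qed.

Lemma dual_measurable (phi : E -> R) :
  dual phi -> measurable_fun [set: borel_type E] (phi : borel_type E -> R).
Proof. by move=> dphi; apply: continuous_measurable_borel; exact: dual_continuous. Qed.

Lemma trig_measurable p : trig_poly p ->
  measurable_fun [set: borel_type E] (p : borel_type E -> R).
Proof.
elim=> {p} [phi c dphi|p q _ mp _ mq|a p _ mp].
- apply: (@measurable_cos_comp _ (borel_type E) R (fun x => phi x + c)).
  by apply: measurable_funD => //; exact: dual_measurable.
- exact: measurable_funD.
- exact: measurable_funM.
Qed.

End trig_poly.

Section trig_approximation.
Context {R : realType} {E : completeNormedModType R}.
Variable nu : {measure set (borel_type E) -> \bar R}.
Hypothesis nufin : (nu [set: borel_type E] < +oo)%E.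
Local Notation mfun g := (measurable_fun [set: borel_type E] (g : borel_type E -> R)).
Implicit Types g p q : E -> R.

Definition unit_valued g := forall x, 0 <= g x <= 1.

Let L1 g p := \int[nu]_x `|g x - p x|.

(** Approximation in L1 of nu, by trigonometric polynomials that stay between 0
    and 1: this last constraint makes the class stable under products, and later
    turns into a bound by the supremum norm. *)
Definition trig_approx g := [/\ mfun g, unit_valued g &
  forall e, 0 < e -> exists p, [/\ trig_poly p, unit_valued p & L1 g p <= e]].

Let unit_integrable g p : mfun g -> mfun p -> unit_valued g -> unit_valued p ->
  nu.-integrable [set: borel_type E] (EFin \o (fun x => `|g x - p x|)).
Proof.
move=> mg mp g1 p1; apply: (bounded_integrable measurableT nufin (M := 1)).
  by apply: measurableT_comp => //; exact: measurable_funB.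
move=> x _; rewrite normr_id ler_norml.
by have := g1 x; have := p1 x; move=> /andP[? ?] /andP[? ?]; apply/andP; split; lra.
Qed.

Let integrable_addr (f h : E -> R) :
  nu.-integrable [set: borel_type E] (EFin \o f) ->
  nu.-integrable [set: borel_type E] (EFin \o h) ->
  nu.-integrable [set: borel_type E] (EFin \o (fun x => f x + h x)).
Proof. by move=> fi hi; exact: (integrableD measurableT fi hi). Qed.

Let L1_triangle g p q : mfun g -> mfun p -> mfun q -> unit_valued g ->
  unit_valued p -> unit_valued q -> L1 g q <= L1 g p + L1 p q.
Proof.
move=> mg mp mq g1 p1 q1; rewrite -RintegralD//; try exact: unit_integrable.
apply: le_Rintegral => //; first exact: unit_integrable.
  by apply: integrable_addr; exact: unit_integrable.
by move=> x _; rewrite (le_trans _ (ler_normD _ _))// addrA subrK.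
Qed.

Lemma trig_approx_refl p : trig_poly p -> unit_valued p -> trig_approx p.
Proof.
move=> tp p1; split => //; first exact: trig_measurable.
move=> e e0; exists p; split => //.
rewrite /L1; under eq_Rintegral do rewrite subrr normr0.
by rewrite Rintegral_cst// mul0r ltW.
Qed.

Lemma trig_approx_lim (g_ : nat -> E -> R) g : (forall n, trig_approx (g_ n)) ->
  (forall x, g_ n x @[n --> \oo] --> g x) -> trig_approx g.
Proof.
move=> g_t g_g.
have mg_ n : mfun (g_ n) by have [] := g_t n.
have g_1 n : unit_valued (g_ n) by have [] := g_t n.
have mg : mfun g by apply: measurable_fun_cvg => [n|x _]; [exact: mg_|exact: g_g].
have g1 : unit_valued g.
  move=> x; apply/andP; split.
    rewrite -(cvg_lim _ (g_g x))//; apply: limr_ge; first exact: cvgP (g_g x).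
    by apply: nearW => n; have /andP[] := g_1 n x.
  rewrite -(cvg_lim _ (g_g x))//; apply: limr_le; first exact: cvgP (g_g x).
  by apply: nearW => n; have /andP[] := g_1 n x.
split => // e e0.
have L10 : L1 g (g_ n) @[n --> \oo] --> 0.
  have : (\int[nu]_x `|g x - g_ n x|%:E)%E @[n --> \oo] --> 0%:E.
    have := @dominated_cvg _ (borel_type E) _ nu setT measurableT
      (fun n x => `|g x - g_ n x|%:E) (cst 0%E) (cst 1%E).
    rewrite integral0; apply=> [n|x _|//||n x _].
    - apply/measurable_EFinP; apply: measurableT_comp => //.
      by apply: measurable_funB => //; exact: mg_.
    - apply: cvg_EFin; first exact: nearW.
      rewrite /comp /= -(@normr0 _ R) -(subrr (g x)).
      by apply: cvg_norm; apply: cvgB; [exact: cvg_cst|exact: g_g].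
    - by apply: (bounded_integrable measurableT nufin (M := 1)) => // x _; rewrite normr1.
    - rewrite /= lee_fin normr_id ler_norml.
      by have := g1 x; have := g_1 n x; move=> /andP[? ?] /andP[? ?]; apply/andP; split; lra.
  exact: fine_cvg.
have e20 : 0 < e / 2 by rewrite divr_gt0.
have [N _ /(_ N (leqnn N)) LN] := cvgr_lt 0 L10 _ e20.
have [_ _ /(_ _ e20)[p [tp p1 Lp]]] := g_t N.
exists p; split => //.
rewrite (le_trans (L1_triangle mg (mg_ N) (trig_measurable tp) g1 (g_1 N) p1))//.
by rewrite [leRHS](splitr e) lerD// ltW.
Qed.

Lemma trig_approx_onem g : trig_approx g -> trig_approx (fun x => 1 - g x).
Proof.
move=> [mg g1 gt]; split.
- exact: measurable_funB.
- by move=> x; have := g1 x; lra.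
move=> e /gt[p [tp p1 Lp]]; exists (fun x => 1 - p x); split.
- exact: trig_onem.
- by move=> x; have := p1 x; lra.
apply: le_trans Lp; rewrite /L1 le_eqVlt; apply/orP; left; apply/eqP.
by apply: eq_Rintegral => x _; rewrite distrC; congr (`|_|); ring.
Qed.

(** Because |g h - p q| <= |g - p| + |h - q| for functions between 0 and 1. *)
Lemma trig_approx_mul g h : trig_approx g -> trig_approx h ->
  trig_approx (fun x => g x * h x).
Proof.
move=> [mg g1 gt] [mh h1 ht].
have unit_mul (a b : E -> R) : unit_valued a -> unit_valued b -> unit_valued (fun x => a x * b x).
  by move=> a1 b1 x; have := a1 x; have := b1 x; nra.
split; [exact: measurable_funM|exact: unit_mul|].
move=> e e0; have e20 : 0 < e / 2 by rewrite divr_gt0.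
have [p [tp p1 Lp]] := gt _ e20; have [q [tq q1 Lq]] := ht _ e20.
exists (fun x => p x * q x); split; [exact: trig_mul|exact: unit_mul|].
have mp := trig_measurable tp; have mq := trig_measurable tq.
rewrite [leRHS](splitr e) (le_trans _ (lerD Lp Lq))// -RintegralD//; try exact: unit_integrable.
apply: le_Rintegral => //.
- by apply: unit_integrable; [exact: measurable_funM..|exact: unit_mul|exact: unit_mul].
- by apply: integrable_addr; exact: unit_integrable.
move=> x _; have -> : g x * h x - p x * q x = (g x - p x) * h x + p x * (h x - q x) by ring.
rewrite (le_trans (ler_normD _ _))// !normrM lerD//.
  have /andP[h0 h1'] := h1 x.
  by rewrite ler_piMr// ger0_norm.
have /andP[p0 p1'] := p1 x.
by rewrite ler_piMl// ger0_norm.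
Qed.

Lemma trig_approx_convex (a : R) g h : 0 <= a -> a <= 1 -> trig_approx g -> trig_approx h ->
  trig_approx (fun x => a * g x + (1 - a) * h x).
Proof.
move=> a0 a1 [mg g1 gt] [mh h1 ht].
have unit_conv (u v : E -> R) : unit_valued u -> unit_valued v ->
    unit_valued (fun x => a * u x + (1 - a) * v x).
  by move=> u1 v1 x; have := u1 x; have := v1 x; nra.
have meas_conv (u v : E -> R) : mfun u -> mfun v -> mfun (fun x => a * u x + (1 - a) * v x).
  by move=> mu_ mv; apply: measurable_funD; exact: measurable_funM.
split; [exact: meas_conv|exact: unit_conv|].
move=> e e0; have e20 : 0 < e / 2 by rewrite divr_gt0.
have [p [tp p1 Lp]] := gt _ e20; have [q [tq q1 Lq]] := ht _ e20.
exists (fun x => a * p x + (1 - a) * q x); split.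
- by apply: trig_add; exact: trig_scale.
- exact: unit_conv.
have mp := trig_measurable tp; have mq := trig_measurable tq.
rewrite [leRHS](splitr e) (le_trans _ (lerD Lp Lq))// -RintegralD//; try exact: unit_integrable.
apply: le_Rintegral => //.
- by apply: unit_integrable; [exact: meas_conv|exact: meas_conv|exact: unit_conv|exact: unit_conv].
- by apply: integrable_addr; exact: unit_integrable.
move=> x _.
have -> : a * g x + (1 - a) * h x - (a * p x + (1 - a) * q x) =
  a * (g x - p x) + (1 - a) * (h x - q x) by ring.
rewrite (le_trans (ler_normD _ _))// !normrM lerD//.
  by rewrite ler_piMl// ger0_norm.
by rewrite ler_piMl// ger0_norm ?subr_ge0// lerBlDr lerDl.
Qed.

End trig_approximation.

Section borel_trig_approximation.
Context {R : realType} {E : completeNormedModType R}.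
Variable nu : {measure set (borel_type E) -> \bar R}.
Hypothesis nufin : (nu [set: borel_type E] < +oo)%E.
Implicit Types (phi p g : E -> R) (B : set E).

(** The thresholds of (1 + cos (phi + c)) / 2 converge to the indicator of
    cos (phi + c) < 0. *)
Let trig_approx_cos_lt0 phi c : dual phi ->
  trig_approx nu (fun x => (cos (phi x + c) < 0)%R%:R).
Proof.
move=> dphi; pose u x := 2^-1 * (1 + cos (phi x + c)).
have tu : trig_poly u.
  by apply: trig_scale; apply: trig_add; [exact: trig_cst|exact: trig_cos].
have u01 x : 0 <= u x <= 1.
  by rewrite /u; have := cos_geN1 (phi x + c); have := cos_le1 (phi x + c); lra.
apply: (trig_approx_lim nufin (g_ := fun n x => threshold n (u x))) => [n|x].
  apply: trig_approx_refl.
    by apply: trig_exp; apply: trig_onem; exact: trig_exp.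
  by move=> x; have /andP[? ?] := u01 x; exact: threshold_01.
have /andP[u0 u1] := u01 x.
have -> : (cos (phi x + c) < 0) = (u x < 1 / 2).
  by rewrite /u; apply/idP/idP; lra.
exact: cvg_threshold.
Qed.

(** The half-space is the pointwise limit of the sets where
    sin ((phi - a) / (n + 1)) is positive. *)
Let trig_approx_halfspace phi a : dual phi ->
  trig_approx nu (\1_[set x | a < phi x] : E -> R).
Proof.
move=> dphi.
apply: (trig_approx_lim nufin (g_ := fun n x =>
   (cos (n.+1%:R^-1 * phi x + (- (n.+1%:R^-1 * a) + pi / 2)) < 0)%R%:R)) => [n|x].
  by apply: trig_approx_cos_lt0; exact: dual_scale.
apply: cvg_near_cst; near=> n.
rewrite addrA -mulrBr cosDpihalf oppr_lt0 indicE.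
have -> : (x \in [set x | a < phi x]) = (a < phi x).
  by apply/idP/idP => [/set_mem//|h]; exact/mem_set.
set y := phi x - a.
have ypi : n.+1%:R^-1 * `|y| < pi.
  rewrite ltr_pdivrMl// -ltr_pdivrMr ?pi_gt0//.
  by rewrite (lt_trans _ (_ : n%:R < n.+1%:R))// ?ltr_nat//; near: n; exact: nbhs_infty_gtr.
have [ay|ya] := ltP a (phi x).
  have y0 : 0 < y by rewrite subr_gt0.
  by rewrite gtr0_norm// in ypi; rewrite sin_gt0_pi// mulr_gt0.
have y0 : y <= 0 by rewrite subr_le0.
rewrite ler0_norm// in ypi.
have : 0 <= sin (- (n.+1%:R^-1 * y)).
  apply: sin_ge0_pi; rewrite -mulrN mulr_ge0 ?oppr_ge0//=; exact: ltW.
by rewrite sinN oppr_ge0 leNgt => /negbTE ->.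
Unshelve. all: by end_near. Qed.

Let approx_set : set (set E) := [set B | trig_approx nu (\1_B : E -> R)].

Let approx_setC B : approx_set B -> approx_set (~` B).
Proof.
move=> /trig_approx_onem; rewrite /approx_set /=.
congr (trig_approx nu); apply/funext => x; rewrite !indicE in_setC.
by case: (x \in B); rewrite ?subrr ?subr0.
Qed.

Let approx_bigcup (F : nat -> set E) : (forall n, approx_set (F n)) ->
  approx_set (\bigcup_n F n).
Proof.
move=> aF.
apply: (trig_approx_lim nufin (g_ := fun n x => 1 - \prod_(k < n) (1 - \1_(F k) x))).
  move=> n; apply: trig_approx_onem; elim: n => [|n IH].
    under eq_fun do rewrite big_ord0.
    apply: trig_approx_refl; first exact: trig_cst.
    by move=> x; rewrite ler01 lexx.
  under eq_fun do rewrite big_ord_recr/=.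
  by apply: (trig_approx_mul nufin) => //; apply: trig_approx_onem; exact: aF.
move=> x; apply: cvg_near_cst.
have [[k _ Fk]|nF] := pselect ((\bigcup_n F n) x).
  near=> n; have kn : (k < n)%N by near: n; exact: nbhs_infty_gt.
  rewrite (bigD1 (Ordinal kn))//= !indicE mem_set//.
  by rewrite subrr mul0r subr0 mem_set//; exists k.
apply: nearW => n; rewrite big1 => [|k _].
  by rewrite subrr indicE memNset.
by rewrite indicE memNset ?subr0// => Fk; apply: nF; exists k.
Unshelve. all: by end_near. Qed.

Hypothesis hE : separable E.

(** A closed ball is a countable intersection of half-spaces, by norming
    functionals. *)
Let approx_closed_ball x r : approx_set [set y | `|y - x| <= r].
Proof.
have [phi [dphi phi_le phi_sup]] := separable_norming_seq hE.
have -> : [set y | `|y - x| <= r] = ~` (\bigcup_n [set y | r + phi n x < phi n y]).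
  apply/seteqP; split=> y /= h.
    move=> [n _] /=; apply/negP; rewrite -leNgt -lerBlDr -dualB//.
    by rewrite (le_trans (ler_norm _))// (le_trans (phi_le _ _)).
  rewrite leNgt; apply/negP => rx; apply: h.
  have [n hn] := phi_sup (y - x) (`|y - x| - r) (ltac:(by rewrite subr_gt0)).
  exists n => //=; rewrite -ltrBrDr -dualB//.
  by move: hn; rewrite opprB addrC subrK.
by apply: approx_setC; apply: approx_bigcup => n; exact: trig_approx_halfspace.
Qed.

(** By separability an open set is a countable union of closed balls. *)
Let approx_open U : open U -> approx_set U.
Proof.
move=> oU; have [a aP] := separable_dense_seq hE.
pose F n k := if `[< [set y | `|y - a n| <= k.+1%:R^-1] `<=` U >]
  then [set y | `|y - a n| <= k.+1%:R^-1] else set0.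
have set0a : approx_set set0.
  apply: trig_approx_refl; rewrite indic0; first exact: trig_cst.
  by move=> x; rewrite lexx ler01.
have -> : U = \bigcup_n \bigcup_k F n k.
  apply/seteqP; split=> x.
    move=> Ux; have /nbhs_ballP[e /= e0 eU] := open_nbhs_nbhs (conj oU Ux).
    have [k _ /(_ k (leqnn k)) ke] := near_infty_natSinv_lt (PosNum (divr_gt0 e0 (ltr0Sn _ 1))).
    have [n xn] := aP x k.+1%:R^-1 (ltac:(by rewrite invr_gt0)).
    exists n => //; exists k => //; rewrite /F asboolT/=; first exact: ltW.
    move=> y /= yn; apply: eU; rewrite -ball_normE/=.
    rewrite (le_lt_trans (ler_distD (a n) _ _))//.
    by move: ke xn yn => /=; rewrite (distrC y); move: (k.+1%:R^-1) => z; lra.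
  by move=> [n _ [k _]]; rewrite /F; case: asboolP => // FU /FU.
apply: approx_bigcup => n; apply: approx_bigcup => k.
by rewrite /F; case: ifP => _ //; exact: approx_closed_ball.
Qed.

(** The sets whose indicator can be approximated form a sigma-algebra that
    contains the open sets. *)
Lemma trig_approx_borel (B : set (borel_type E)) :
  measurable B -> trig_approx nu (\1_B : E -> R).
Proof.
move=> mB; have : <<s @open E >> `<=` approx_set; last exact.
apply: smallest_sub; last by move=> U; exact: approx_open.
split=> [|A aA|F aF]; [|by rewrite setTD; exact: approx_setC|exact: approx_bigcup].
exact/approx_open/open0.
Qed.

(** This bound and the next say that, for 0 <= y <= n, the number of the integers
    1, ..., n that are at most y differs from y by at most 1: a layer-cake
    decomposition of y. *)
Let layers_le n (y : R) : 0 <= y -> \sum_(k < n) (k.+1%:R <= y)%R%:R <= y.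
Proof.
move=> y0; elim: n => [|n IH]; first by rewrite big_ord0.
rewrite big_ord_recr/=; case: (leP n.+1%:R y) => ny; last by rewrite addr0.
rewrite (le_trans _ ny)// -natr1 lerD2r.
apply: (@le_trans _ _ (\sum_(k < n) (1 : R))); last by rewrite sumr_const card_ord.
by apply: ler_sum => k _; rewrite lern1 leq_b1.
Qed.

Let layers_ge n (y : R) : y <= n%:R -> y - 1 <= \sum_(k < n) (k.+1%:R <= y)%R%:R.
Proof.
elim: n => [|n IH] yn; first by rewrite big_ord0; lra.
rewrite big_ord_recr/=; case: (leP y n%:R) => ny.
  by rewrite (le_trans (IH ny))// lerDl.
have -> : \sum_(k < n) (k.+1%:R <= y)%R%:R = n%:R :> R.
  rewrite (eq_bigr (fun=> 1)) ?sumr_const ?card_ord// => k _.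
  by rewrite (le_trans _ (ltW ny))// ler_nat.
rewrite -natr1 in yn; have : 0 <= ((n.+1%:R <= y)%R%:R : R) by [].
by move: ((n.+1%:R <= y)%R%:R) => b; lra.
Qed.

Let trig_approx_mean (h : nat -> E -> R) n : (forall k, trig_approx nu (h k)) ->
  trig_approx nu (fun x => n.+1%:R^-1 * \sum_(k < n.+1) h k x).
Proof.
move=> th; elim: n => [|n IH].
  have := th 0%N; congr trig_approx; apply/funext => x.
  by rewrite big_ord1 invr1 mul1r.
have := @trig_approx_convex _ _ _ nufin n.+2%:R^-1 _ _ _ _ (th n.+1) IH.
have -> : (fun x => n.+2%:R^-1 * h n.+1 x +
    (1 - n.+2%:R^-1) * (n.+1%:R^-1 * \sum_(k < n.+1) h k x)) =
    (fun x => n.+2%:R^-1 * \sum_(k < n.+2) h k x).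
  apply/funext => x; rewrite [in RHS]big_ord_recr/=.
  move: (\sum_(k < n.+1) _) => a; rewrite -(natr1 n.+1).
  have : n.+1%:R != 0 :> R by [].
  have : n.+1%:R + 1 != 0 :> R by rewrite natr1.
  by move: (n.+1%:R : R) => m m1 m0; field; apply/andP.
by apply; rewrite ?invr_ge0// invf_le1// ler1n.
Qed.

(** The function g is the uniform limit of the means of the indicators of
    g >= (k + 1) / (n + 1), for k = 0, ..., n. *)
Lemma trig_approx_measurable g :
  measurable_fun [set: borel_type E] (g : borel_type E -> R) -> unit_valued g ->
  trig_approx nu g.
Proof.
move=> mg g1.
pose h n k := \1_[set x | k.+1%:R <= n.+1%:R * g x] : E -> R.
have hind n k x : h n k x = (k.+1%:R <= n.+1%:R * g x)%R%:R.
  rewrite /h indicE; congr (_%:R); congr nat_of_bool.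
  by apply/idP/idP => [/set_mem//|?]; exact/mem_set.
apply: (trig_approx_lim nufin (g_ := fun n x => n.+1%:R^-1 * \sum_(k < n.+1) h n k x)).
  move=> n; apply: trig_approx_mean => k; apply: trig_approx_borel.
  have -> : [set x | k.+1%:R <= n.+1%:R * g x] =
      (fun x : borel_type E => n.+1%:R * g x) @^-1` `[k.+1%:R, +oo[.
    by apply/seteqP; split=> x /=; rewrite in_itv/= andbT.
  rewrite -[_ @^-1` _]setTI.
  have mng : measurable_fun [set: borel_type E] (fun x : borel_type E => n.+1%:R * g x).
    exact: measurable_funM.
  exact: mng.
move=> x; apply: (@cvg_dist_le _ R^o _ (fun n => n.+1%:R^-1)) => [n|].
  have /andP[g0 g1'] := g1 x.
  under eq_bigr do rewrite hind.
  have y0 : 0 <= n.+1%:R * g x by rewrite mulr_ge0.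
  have yn : n.+1%:R * g x <= n.+1%:R by rewrite ler_piMr.
  have := layers_le n.+1 y0; have := layers_ge yn.
  move: (\sum_(k < n.+1) _) => a a1 a2.
  have -> : g x - n.+1%:R^-1 * a = n.+1%:R^-1 * (n.+1%:R * g x - a).
    by rewrite mulrBr mulKf.
  rewrite normrM ger0_norm ?invr_ge0// ler_piMr ?invr_ge0//.
  by rewrite ger0_norm ?subr_ge0//; lra.
exact: cvg_harmonic.
Qed.

End borel_trig_approximation.

(** * Translations of a Gaussian measure *)

Section common_dominating_measure.
Context {d : measure_display} {T : measurableType d} {R : realType}.
Variables (P : probability T R) (X : T -> T).
Hypothesis mX : measurable_fun [set: T] X.

(** Take the sum of P and its image under X: approximation in L1 of that sum
    controls integrals before and after the map X. *)
Lemma exists_dominating_measure : exists nu : {measure set T -> \bar R},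
  (nu [set: T] < +oo)%E /\
  forall g : T -> R, measurable_fun [set: T] g -> (forall x, 0 <= g x <= 1) ->
    \int[P]_x g x <= \int[nu]_x g x /\ \int[P]_x g (X x) <= \int[nu]_x g x.
Proof.
have PX1 : pushforward P X [set: T] = 1%E.
  by rewrite /pushforward preimage_setT probability_setT.
pose nu1 := measure_add P (pushforward P X).
pose nu : {measure set T -> \bar R} := nu1 mX.
have nufin : (nu [set: T] < +oo)%E.
  have -> : nu [set: T] = (P [set: T] + pushforward P X [set: T])%E.
    exact: measure_addE.
  by rewrite PX1 probability_setT ltry.
exists nu; split => // g mg g01.
have mgE : measurable_fun [set: T] (EFin \o g) by exact/measurable_EFinP.
have g0 x : (0 <= (g x)%:E)%E by rewrite lee_fin; have /andP[] := g01 x.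
have g1 x : `|g x| <= 1 by have /andP[? ?] := g01 x; rewrite ger0_norm.
have nuE : (\int[nu]_x (g x)%:E = \int[P]_x (g x)%:E + \int[P]_x (g (X x))%:E)%E.
  rewrite /nu /nu1 ge0_integral_measure_add//; congr (_ + _)%E.
  have := @ge0_integral_pushforward _ _ _ _ _ _ mX P setT (EFin \o g) measurableT.
  by rewrite preimage_setT; apply=> // x _; exact: g0.
have iPg := prob_bounded_integrable P mg g1.
have iPgX : P.-integrable [set: T] (EFin \o (g \o X)).
  by apply: prob_bounded_integrable => [|x]; [exact: measurableT_comp mg mX|exact: g1].
have finnu : (\int[nu]_x (g x)%:E)%E \is a fin_num.
  rewrite nuE fin_numD; apply/andP; split; exact: integrable_fin_num.
rewrite /Rintegral; split; rewrite fine_le//; rewrite ?nuE.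
- exact: integrable_fin_num iPg.
- by rewrite leeDl// integral_ge0.
- exact: integrable_fin_num iPgX.
- by rewrite leeDr// integral_ge0.
Qed.

End common_dominating_measure.

Section gaussian_shift.
Context {R : realType} {E : completeNormedModType R}.
Variable mu : probability (borel_type E) R.
Hypothesis gmu : centred_gaussian mu.
Implicit Types phi psi p : E -> R.

Definition cov phi psi := \int[mu]_x (phi x * psi x).

Let mdual phi : dual phi -> measurable_fun [set: borel_type E] (phi : borel_type E -> R).
Proof. exact: dual_measurable. Qed.

Let dual_law phi : dual phi -> centred_gaussian_law (pushforward mu phi).
Proof. by move=> /dual_linear[f cf <-]; exact: gmu. Qed.

Lemma dual_sqr_integrable phi : dual phi ->
  mu.-integrable [set: borel_type E] (EFin \o (fun x => phi x ^+ 2)).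
Proof. by move=> dphi; exact: (gaussian_square_integrable (mdual dphi) (dual_law dphi)). Qed.

(** The expression cov phi phi, as integral of phi ^ 2, is the variance of the
    Gaussian variable phi. *)
Lemma dual_cos phi c : dual phi ->
  \int[mu]_x cos (phi x + c) = cos c * expR (- (cov phi phi / 2)).
Proof.
move=> dphi; rewrite (gaussian_cos (mdual dphi) (dual_law dphi)).
by congr (_ * expR (- (_ / 2))); apply: eq_Rintegral => x _; rewrite expr2.
Qed.

Lemma dual_mul_integrable phi psi : dual phi -> dual psi ->
  mu.-integrable [set: borel_type E] (EFin \o (fun x => phi x * psi x)).
Proof.
move=> dphi dpsi.
apply: (le_integrable measurableT _ _ (integrableD measurableT
  (dual_sqr_integrable dphi) (dual_sqr_integrable dpsi))).
  by apply/measurable_EFinP; apply: measurable_funM; exact: mdual.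
move=> x _ /=; rewrite lee_fin normrM (le_trans _ (ler_norm _))//.
rewrite -(real_normK (num_real (phi x))) -(real_normK (num_real (psi x))).
move: (normr_ge0 (phi x)) (normr_ge0 (psi x)); move: `|phi x| `|psi x| => a b a0 b0.
by have := sqr_ge0 (a - b); nra.
Qed.

Lemma cov_ge0 phi : 0 <= cov phi phi.
Proof. by apply: Rintegral_ge0 => x _; rewrite -expr2 sqr_ge0. Qed.

Lemma cov_lincomb phi psi a : dual phi -> dual psi ->
  cov (fun x => phi x + a * psi x) (fun x => phi x + a * psi x) =
  cov phi phi + 2 * a * cov phi psi + a ^+ 2 * cov psi psi.
Proof.
move=> dphi dpsi.
have i1 := dual_mul_integrable dphi dphi.
have i2 := dual_mul_integrable dphi dpsi.
have i3 := dual_mul_integrable dpsi dpsi.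
have i2' : mu.-integrable [set: borel_type E]
    (EFin \o (fun x => 2 * a * (phi x * psi x))).
  exact: (integrableZl measurableT (2 * a) i2).
have i3' : mu.-integrable [set: borel_type E]
    (EFin \o (fun x => a ^+ 2 * (psi x * psi x))).
  exact: (integrableZl measurableT (a ^+ 2) i3).
have i12 : mu.-integrable [set: borel_type E]
    (EFin \o (fun x => phi x * phi x + 2 * a * (phi x * psi x))).
  exact: (integrableD measurableT i1 i2').
rewrite /cov -RintegralZl// -RintegralZl// -RintegralD// -RintegralD//.
by apply: eq_Rintegral => x _; ring.
Qed.

(** Gaussian integration by parts: differentiate at r = 0 the identity dual_cos
    for the functional phi + r psi, whose variance is a quadratic polynomial in r.
    Only the laws of single functionals enter. *)
Lemma dual_stein phi psi c : dual phi -> dual psi ->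
  \int[mu]_x (psi x * sin (phi x + c)) =
  cos c * cov phi psi * expR (- (cov phi phi / 2)).
Proof.
move=> dphi dpsi.
have d2 : is_derive (0 : R) (1 : R) (fun r => cos c * expR (- ((cov phi phi + 2 * r * cov phi psi +
      r ^+ 2 * cov psi psi) / 2))) (- (cos c * cov phi psi * expR (- (cov phi phi / 2)))).
  apply: is_derive_eq; rewrite /GRing.scale/= expr0n/= mulr0 !mul0r !addr0 !mulr0.
  by set e := expR _; field.
have := @is_derive_integral_cos _ _ _ mu (fun x => phi x + c) psi 0.
move=> /(_ (measurable_funD (mdual dphi) (measurable_cst _)) (mdual dpsi)
  (dual_sqr_integrable dpsi)) d1.
have E1 : (fun r => \int[mu]_x cos (phi x + c + r * psi x)) =
    (fun r => cos c * expR (- ((cov phi phi + 2 * r * cov phi psi +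
      r ^+ 2 * cov psi psi) / 2))).
  apply/funext => r; rewrite -cov_lincomb// -dual_cos; last exact: dual_lincomb.
  by apply: eq_Rintegral => x _; rewrite addrAC.
rewrite E1 in d1.
have := etrans (esym (@derive_val _ _ _ _ _ _ _ d1)) (@derive_val _ _ _ _ _ _ _ d2).
move=> /oppr_inj <-; apply: eq_Rintegral => x _.
by rewrite mul0r addr0.
Qed.

(** From |psi| <= s / 2 + psi ^ 2 / (2 s). *)
Lemma dual_mean_le psi (s : R) : dual psi -> 0 < s -> cov psi psi <= s ^+ 2 ->
  forall p, measurable_fun [set: borel_type E] (p : borel_type E -> R) ->
  (forall x, `|p x| <= 1) -> `|\int[mu]_x (psi x * p x)| <= s.
Proof.
move=> dpsi s0 vs p mp p1.
have isq := dual_mul_integrable dpsi dpsi.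
have ip : mu.-integrable [set: borel_type E] (EFin \o (fun x => psi x * p x)).
  exact: (square_integrable_bounded_mul (mdual dpsi) mp p1 (dual_sqr_integrable dpsi)).
have i1 : mu.-integrable [set: borel_type E] (EFin \o cst (s / 2)).
  by apply: (@prob_bounded_integrable _ _ _ mu (cst (s / 2)) `|s / 2|).
have i2 : mu.-integrable [set: borel_type E] (EFin \o (fun x => (2 * s)^-1 * (psi x * psi x))).
  exact: (integrableZl measurableT (2 * s)^-1 isq).
have i12 : mu.-integrable [set: borel_type E]
    (EFin \o (fun x => cst (s / 2) x + (2 * s)^-1 * (psi x * psi x))).
  exact: (integrableD measurableT i1 i2).
rewrite (le_trans (le_normr_Rintegral measurableT ip))//.
apply: (@le_trans _ _ (\int[mu]_x (cst (s / 2) x + (2 * s)^-1 * (psi x * psi x)))).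
  apply: le_Rintegral => //; first exact: integrable_norm.
  move=> x _; rewrite normrM (le_trans (ler_wpM2l (normr_ge0 _) (p1 x)))// mulr1 /=.
  rewrite -expr2 -(real_normK (num_real (psi x))); move: `|psi x| => a.
  rewrite -subr_ge0; have -> : s / 2 + (2 * s)^-1 * a ^+ 2 - a = (2 * s)^-1 * (a - s) ^+ 2.
    by field; rewrite gt_eqF.
  by rewrite mulr_ge0 ?sqr_ge0// invr_ge0 mulr_ge0// ltW.
rewrite RintegralD// [X in X + _](prob_Rintegral_cst mu (s / 2)) RintegralZl// -/(cov _ _).
rewrite [leRHS](splitr s) lerD2l ler_pdivrMl ?mulr_gt0//.
by have -> : 2 * s * (s / 2) = s ^+ 2 by field.
Qed.

(** In dual form: h belongs to the Cameron-Martin space of mu with norm at most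
    e. *)
Definition cameron_martin_le (h : E) (e : R) :=
  forall phi, dual phi -> `|phi h| <= e * Num.sqrt (cov phi phi).

(** The covariance of psi with any functional is nearly its value at h. *)
Definition near_representer (h : E) psi (e : R) := forall phi, dual phi ->
  `|cov psi phi - phi h| <= e * Num.sqrt (cov phi phi).

(** Apply approx_riesz to the covariance form and to evaluation at h. *)
Lemma exists_near_representer h e : 0 <= e -> cameron_martin_le h e ->
  forall eta, 0 < eta -> exists psi, [/\ dual psi, near_representer h psi eta &
    cov psi psi <= (e + eta) ^+ 2].
Proof.
move=> e0 he eta eta0.
have [u [du uP u_le]] : exists u : E -> R^o, [/\ dual u,
    forall v : E -> R^o, dual v -> `|cov u v - v h| <= eta * Num.sqrt (cov v v) &
    Num.sqrt (cov u u) <= e + eta].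
  apply: (@approx_riesz R (E -> R^o) (@dual R E) cov (fun phi => phi h) e e0) => //.
  - exact: dual_zero.
  - by move=> a u v du dv; exact: dual_lincomb.
  - by move=> a u v du dv; exact: cov_lincomb.
  - by move=> v dv; exact: cov_ge0.
exists u; split => //.
rewrite -(sqr_sqrtr (cov_ge0 u)) lerXn2r// ?nnegrE ?sqrtr_ge0//.
by rewrite addr_ge0// ltW.
Qed.

Lemma measurable_translation (h : E) :
  measurable_fun [set: borel_type E] (fun x : borel_type E => x + h : borel_type E).
Proof.
apply: (measurability _ (erefl : @measurable _ (borel_type E) = <<s @open E >>)) => _ [U oU <-]; rewrite setTI.
apply: sub_sigma_algebra; apply: open_comp => // x _.
by apply: cvgD; [exact: cvg_id|exact: cvg_cst].
Qed.

Lemma measurable_translate (h : E) (f : E -> R) :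
  measurable_fun [set: borel_type E] (f : borel_type E -> R) ->
  measurable_fun [set: borel_type E] (fun x : borel_type E => f (x + h)).
Proof. by move=> mf; exact: (measurableT_comp mf (measurable_translation h)). Qed.

Let trig_bounded p : trig_poly p -> exists M, forall x, `|p x| <= M.
Proof.
elim=> {p} [phi c _|p q _ [M pM] _ [N qN]|a p _ [M pM]].
- by exists 1 => x; rewrite ler_norml cos_geN1 cos_le1.
- by exists (M + N) => x; rewrite (le_trans (ler_normD _ _))// lerD.
- by exists (`|a| * M) => x; rewrite normrM ler_wpM2l.
Qed.

Let trig_translate_integrable h p : trig_poly p ->
  mu.-integrable [set: borel_type E] (EFin \o (fun x => p (x + h))).
Proof.
move=> tp; have [M pM] := trig_bounded tp.
apply: (@prob_bounded_integrable _ _ _ mu _ M) => //.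
by apply: measurable_translate; exact: trig_measurable.
Qed.

Let dual_trig_translate_integrable h psi p : dual psi -> trig_poly p ->
  mu.-integrable [set: borel_type E] (EFin \o (fun x => psi x * p (x + h))).
Proof.
move=> dpsi tp; have [M pM] := trig_bounded tp.
apply: (square_integrable_bounded_mul (mdual dpsi) _ (fun x => pM (x + h))
  (dual_sqr_integrable dpsi)).
by apply: measurable_translate; exact: trig_measurable.
Qed.

(** For an exact representer psi of h the derivative of the mean of p (x + r h)
    in r is the mean of psi (x) p (x + r h); this is dual_stein when p is a
    cosine, and both sides are linear in p. The constant K depends on p only,
    so the precision eta can be sent to 0 with p fixed. *)
Lemma trig_shift_derivative h p : trig_poly p -> exists dF K, 0 <= K /\
  forall r, is_derive r (1 : R) (fun r => \int[mu]_x p (x + r *: h)) (dF r) /\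
    forall psi eta, dual psi -> 0 <= eta -> near_representer h psi eta ->
      `|dF r - \int[mu]_x (psi x * p (x + r *: h))| <= K * eta.
Proof.
elim=> {p} [phi c dphi|p q tp [dF [K [K0 FK]]] tq [dG [L [L0 GL]]]|a p tp [dF [K [K0 FK]]]].
- have phiE r x : phi (x + r *: h) + c = phi x + (r * phi h + c).
    by rewrite dualD// dualZ// addrA.
  set v := expR (- (cov phi phi / 2)).
  have v0 : 0 <= v by exact: expR_ge0.
  have v1 : v <= 1 by rewrite expR_le1// oppr_le0 divr_ge0// cov_ge0.
  exists (fun r => - (phi h * sin (r * phi h + c) * v)), (Num.sqrt (cov phi phi)).
  split => // r; split.
    have -> : (fun r => \int[mu]_x cos (phi (x + r *: h) + c)) =
        (fun r => cos (r * phi h + c) * v).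
      apply/funext => r'; rewrite -dual_cos//.
      by apply: eq_Rintegral => x _; rewrite phiE.
    by apply: is_derive_eq; rewrite /GRing.scale/=; ring.
  move=> psi eta dpsi eta0 hpsi.
  have -> : \int[mu]_x (psi x * cos (phi (x + r *: h) + c)) =
      - (sin (r * phi h + c) * cov psi phi * v).
    transitivity (\int[mu]_x (psi x * sin (phi x + (r * phi h + c + pi / 2)))).
      by apply: eq_Rintegral => x _; rewrite phiE [in RHS]addrA sinDpihalf.
    rewrite dual_stein// cosDpihalf -/v !mulNr; congr (- (_ * _ * _)).
    by apply: eq_Rintegral => x _; rewrite mulrC.
  have -> : - (phi h * sin (r * phi h + c) * v) - - (sin (r * phi h + c) * cov psi phi * v)
     = (cov psi phi - phi h) * (sin (r * phi h + c) * v) by ring.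
  rewrite normrM (mulrC _ eta) -[leRHS]mulr1 ler_pM//; first exact: hpsi.
  rewrite normrM (ger0_norm v0) mulr_ile1//.
  by rewrite ler_norml sin_geN1 sin_le1.
- exists (fun r => dF r + dG r), (K + L); split; first exact: addr_ge0.
  move=> r; have [dFr FKr] := FK r; have [dGr GLr] := GL r; split.
    have -> : (fun r => \int[mu]_x (p (x + r *: h) + q (x + r *: h))) =
        (fun r => \int[mu]_x p (x + r *: h)) \+ (fun r => \int[mu]_x q (x + r *: h)).
      by apply/funext => r' /=; rewrite RintegralD//; exact: trig_translate_integrable.
    exact: is_deriveD.
  move=> psi eta dpsi eta0 hpsi.
  under eq_Rintegral do rewrite mulrDr.
  rewrite RintegralD//; try exact: dual_trig_translate_integrable.
  rewrite opprD addrACA mulrDl (le_trans (ler_normD _ _))// lerD//.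
    exact: FKr.
  exact: GLr.
- exists (fun r => a * dF r), (`|a| * K); split; first exact: mulr_ge0.
  move=> r; have [dFr FKr] := FK r; split.
    have -> : (fun r => \int[mu]_x (a * p (x + r *: h))) =
        a \*: (fun r => \int[mu]_x p (x + r *: h)).
      by apply/funext => r' /=; rewrite RintegralZl//; exact: trig_translate_integrable.
    exact: is_deriveZ.
  move=> psi eta dpsi eta0 hpsi.
  under eq_Rintegral do rewrite mulrCA.
  rewrite RintegralZl//; last exact: dual_trig_translate_integrable.
  by rewrite -mulrBr normrM -mulrA ler_wpM2l// FKr.
Qed.

(** By the mean value theorem: the derivative is at most the mean of |psi|, hence
    at most the standard deviation of psi, which is nearly e. *)
Lemma trig_shift h e p : 0 <= e -> cameron_martin_le h e -> trig_poly p ->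
  (forall x, `|p x| <= 1) ->
  `|\int[mu]_x p (x + h) - \int[mu]_x p x| <= e.
Proof.
move=> e0 he tp p1; have [dF [K [K0 FK]]] := trig_shift_derivative h tp.
apply/ler_addgt0Pr => d d0.
have K1 : 0 < K + 1 by rewrite ltr_wpDl.
(* With this choice K * eta + eta = d. *)
pose eta := d / (K + 1); have eta0 : 0 < eta by rewrite divr_gt0.
have [psi [dpsi hpsi vpsi]] := exists_near_representer e0 he eta0.
have := @mvt_bound _ (fun r => \int[mu]_x p (x + r *: h)) dF (e + d) 0 1
  (fun r => (FK r).1).
rewrite subr0 normr1 mulr1.
under eq_Rintegral do rewrite scale1r.
under [X in _ - X]eq_Rintegral do rewrite scale0r addr0.
apply=> r _.
have [_ /(_ psi eta dpsi (ltW eta0) hpsi)] := FK r.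
have es : 0 < e + eta by rewrite ltr_wpDl.
have mpr : measurable_fun [set: borel_type E] ((fun x => p (x + r *: h)) : borel_type E -> R).
  by apply: measurable_translate; exact: trig_measurable.
have := dual_mean_le dpsi es vpsi mpr (fun x => p1 (x + r *: h)).
have -> : d = K * eta + eta by rewrite -[X in _ + X]mul1r -mulrDl /eta mulrC divfK// gt_eqF.
by rewrite !ler_norml => /andP[? ?] /andP[? ?]; apply/andP; split; lra.
Qed.

(** Reduce to (f + M) / (2 M), which lies between 0 and 1, and approximate it by
    trigonometric polynomials in L1 of mu and of its translate simultaneously. *)
Lemma gaussian_shift (f : E -> R) (h : E) (e M : R) : separable E ->
  0 <= e -> cameron_martin_le h e ->
  measurable_fun [set: borel_type E] (f : borel_type E -> R) ->
  0 < M -> (forall x, `|f x| <= M) ->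
  `|\int[mu]_x f (x + h) - \int[mu]_x f x| <= 2 * M * e.
Proof.
move=> hE e0 he mf M0 fM.
pose g x := (2 * M)^-1 * (f x + M).
have M20 : 0 < 2 * M by rewrite mulr_gt0.
have mg : measurable_fun [set: borel_type E] (g : borel_type E -> R).
  by apply: measurable_funM => //; exact: measurable_funD.
have g01 : unit_valued g.
  move=> x; have := fM x; rewrite ler_norml => /andP[f1 f2].
  rewrite /g mulr_ge0 ?invr_ge0 ?(ltW M20)//=; last by lra.
  by rewrite ler_pdivrMl// mulr1; lra.
have unit_int (q : E -> R) : measurable_fun [set: borel_type E] (q : borel_type E -> R) ->
    unit_valued q -> mu.-integrable [set: borel_type E] (EFin \o q).
  move=> mq q01; apply: (@prob_bounded_integrable _ _ _ mu q 1) => // x.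
  by have /andP[? ?] := q01 x; rewrite ger0_norm.
have gshift : `|\int[mu]_x g (x + h) - \int[mu]_x g x| <= e.
  apply/ler_addgt0Pr => d d0.
  have [nu [nufin nuP]] := exists_dominating_measure mu (measurable_translation h).
  have [_ _ /(_ (d / 2) (divr_gt0 d0 (ltr0Sn _ 1)))[p [tp p01 Lp]]] :=
    trig_approx_measurable nufin hE mg g01.
  have mp := trig_measurable tp.
  have mgp : measurable_fun [set: borel_type E] (fun x : borel_type E => `|g x - p x|).
    by apply: measurableT_comp => //; exact: measurable_funB.
  have gp01 : unit_valued (fun x => `|g x - p x|).
    move=> x; rewrite normr_ge0 ler_norml.
    by have /andP[? ?] := g01 x; have /andP[? ?] := p01 x; apply/andP; split; lra.
  have [h1 h2] := nuP _ mgp gp01.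
  have p1 x : `|p x| <= 1 by have /andP[? ?] := p01 x; rewrite ger0_norm.
  have h3 := trig_shift e0 he tp p1.
  have ig := unit_int _ mg g01; have ip := unit_int _ mp p01.
  have igh := unit_int _ (measurable_translate h mg) (fun x => g01 (x + h)).
  have iph := unit_int _ (measurable_translate h mp) (fun x => p01 (x + h)).
  have h4 : `|\int[mu]_x g x - \int[mu]_x p x| <= d / 2.
    rewrite -RintegralB// (le_trans (le_normr_Rintegral measurableT _))//.
      exact: (integrableB measurableT ig ip).
    exact: le_trans h1 Lp.
  have h5 : `|\int[mu]_x g (x + h) - \int[mu]_x p (x + h)| <= d / 2.
    rewrite -RintegralB// (le_trans (le_normr_Rintegral measurableT _))//.
      exact: (integrableB measurableT igh iph).
    exact: le_trans h2 Lp.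
  move: h3 h4 h5; rewrite !ler_norml => /andP[? ?] /andP[? ?] /andP[? ?].
  by apply/andP; split; lra.
have fE x : f x = 2 * M * g x - M by rewrite /g mulVKf ?gt_eqF// addrK.
have intE k : \int[mu]_x f (x + k) = 2 * M * \int[mu]_x g (x + k) - M.
  have igk := unit_int _ (measurable_translate k mg) (fun x => g01 (x + k)).
  under eq_Rintegral do rewrite fE.
  rewrite RintegralB//; last 2 first.
  - exact: (integrableZl measurableT (2 * M) igk).
  - by apply: (@prob_bounded_integrable _ _ _ mu (cst M) `|M|).
  by rewrite RintegralZl// [X in _ - X](prob_Rintegral_cst mu M).
have intE0 : \int[mu]_x f x = 2 * M * \int[mu]_x g x - M.
  have := intE 0; under eq_Rintegral do rewrite addr0.
  by under [X in _ = _ * X - _]eq_Rintegral do rewrite addr0.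
rewrite intE intE0 opprB addrA subrK -mulrBr normrM (gtr0_norm M20).
by rewrite ler_wpM2l// ltW.
Qed.

End gaussian_shift.

Section gaussian_dichotomy.
Context {R : realType} {E : completeNormedModType R}.
Variable mu : probability (borel_type E) R.
Hypothesis gmu : centred_gaussian mu.
Implicit Types phi : E -> R.

Lemma cov_scale phi a : dual phi ->
  cov mu (fun x => a * phi x) (fun x => a * phi x) = a ^+ 2 * cov mu phi phi.
Proof.
move=> dphi; rewrite /cov -RintegralZl//; last exact: dual_mul_integrable.
by apply: eq_Rintegral => x _; ring.
Qed.

Lemma indic_Rintegral (A : set (borel_type E)) : measurable A ->
  (\int[mu]_x (\1_A x : R))%:E = mu A.
Proof.
move=> mA; rewrite /Rintegral integral_indic// setIT fineK//.
exact: fin_num_measure.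
Qed.

Lemma measurable_dual_ge1 phi : dual phi ->
  measurable ([set x | (1 <= `|phi x|)%R] : set (borel_type E)).
Proof.
move=> dphi.
have mphi : measurable_fun [set: borel_type E] (fun x : borel_type E => `|phi x|).
  by apply: measurableT_comp => //; exact: dual_measurable.
have -> : [set x | (1 <= `|phi x|)%R] =
    [set: borel_type E] `&` (fun x => `|phi x|) @^-1` `[1, +oo[.
  by rewrite setTI; apply/seteqP; split=> x /=; rewrite in_itv/= andbT.
exact: mphi.
Qed.

Lemma dual_chebyshev phi : dual phi ->
  (mu [set x | (1 <= `|phi x|)%R] <= (cov mu phi phi)%:E)%E.
Proof.
move=> dphi; set B := [set x | _].
have mB : measurable (B : set (borel_type E)) by exact: measurable_dual_ge1.
rewrite -indic_Rintegral// lee_fin; apply: le_Rintegral => //.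
- apply: (@prob_bounded_integrable _ _ _ mu _ 1) => // x.
  by rewrite indicE; case: (_ \in _); rewrite ?normr1 ?normr0.
- exact: dual_mul_integrable.
move=> x _; rewrite indicE; case: (boolP (x \in B)) => [/set_mem /= Bx|_].
  by rewrite -expr2 -(real_normK (num_real (phi x))) expr_ge1.
by rewrite -expr2 sqr_ge0.
Qed.

(** A functional that violates the bound with C = (n + 1) 2 ^ (n + 1), rescaled to
    take the value n at z. *)
Let unbounded_functional z : ~ (exists C, forall phi, dual phi ->
    `|phi z| <= C * Num.sqrt (cov mu phi phi)) ->
  forall n : nat, exists phi, [/\ dual phi, phi z = n%:R &
    cov mu phi phi <= 1 / (2 ^ n.+1)%:R].
Proof.
move=> nC n; pose c : R := n.+1%:R * (2 ^ n.+1)%:R.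
have [phi [dphi phic]] : exists phi, dual phi /\ c * Num.sqrt (cov mu phi phi) < `|phi z|.
  apply: contrapT => /forallNP h; apply: nC; exists c => phi dphi.
  by rewrite leNgt; apply/negP => phic; apply: (h phi).
have c0 : 0 <= c by rewrite /c mulr_ge0.
have phiz : 0 < `|phi z| by rewrite (le_lt_trans _ phic)// mulr_ge0// sqrtr_ge0.
exists (fun x => (n%:R / phi z) * phi x); split.
- exact: dual_scale.
- by rewrite divfK// -normr_gt0.
rewrite cov_scale//.
have vphi : c ^+ 2 * cov mu phi phi <= `|phi z| ^+ 2.
  rewrite -(sqr_sqrtr (cov_ge0 mu phi)) -exprMn.
  apply: lerXn2r; rewrite ?nnegrE ?normr_ge0//; last exact: ltW.
  by rewrite mulr_ge0// sqrtr_ge0.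
have a0 : 0 < `|phi z| ^+ 2 by rewrite exprn_gt0.
have k1 : 1 <= (2 ^ n.+1)%:R :> R by rewrite ler1n expn_gt0.
rewrite exprMn exprVn -(real_normK (num_real (phi z))).
move: (cov_ge0 mu phi) vphi a0; rewrite /c -natr1.
move: (cov mu phi phi) (_ ^+ 2) (n%:R : R) (ler0n R n) ((2 ^ n.+1)%:R : R) k1.
move=> v a m m0 k k1 v0 vphi a0.
rewrite ler_pdivlMr ?(lt_le_trans _ k1)//.
have -> : m ^+ 2 / a * v * k = (m ^+ 2 * k * v) / a by rewrite -!mulrA; ring.
rewrite ler_pdivrMr// mul1r (le_trans _ vphi)// ler_wpM2r//.
have : m ^+ 2 * k <= m ^+ 2 * k ^+ 2 by rewrite ler_wpM2l ?sqr_ge0// expr2; nra.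
have : 0 <= k ^+ 2 * (2 * m + 1) by rewrite mulr_ge0 ?sqr_ge0//; lra.
by nra.
Qed.

(** Otherwise there are functionals phi n with phi n (z) = n and summable
    variances. By the Borel-Cantelli lemma almost every y satisfies |phi n (y)| < 1
    for all large n, but then y + e z does not, for any e > 0. So the set of such
    y has measure 1, while its translates by nonzero multiples of z have measure 0. *)
Lemma cameron_martin_of_continuity z :
  (forall A : set (borel_type E), measurable A ->
    \int[mu]_y (\1_A (n.+1%:R^-1 *: z + y) : R) @[n --> \oo] -->
    \int[mu]_y (\1_A y : R)) ->
  exists C, forall phi, dual phi -> `|phi z| <= C * Num.sqrt (cov mu phi phi).
Proof.
move=> tc; apply: contrapT => /unbounded_functional/choice[phi phiP].
pose B n : set (borel_type E) := [set y | (1 <= `|phi n y|)%R].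
have dphi n : dual (phi n) by have [] := phiP n.
have mB n : measurable (B n) by exact: measurable_dual_ge1.
pose L := lim_sup_set B.
have mL : measurable L.
  by apply: bigcap_measurable => // n _; apply: bigcup_measurable.
have L0 : mu L = 0%E.
  apply: lim_sup_set_cvg0 => //.
  apply: (@le_lt_trans _ _ 1%:E); last by rewrite ltry.
  apply: le_trans (epsilon_trick0 xpredT ler01).
  apply: lee_nneseries => // n _.
  have [_ _ vn] := phiP n.
  by rewrite (le_trans (dual_chebyshev (dphi n)))// lee_fin.
have I1 : \int[mu]_y (\1_(~` L) y : R) = 1.
  apply: EFin_inj; rewrite indic_Rintegral; last exact: measurableC.
  by rewrite probability_setC// L0 sube0.
have I0 n : \int[mu]_y (\1_(~` L) (n.+1%:R^-1 *: z + y) : R) = 0.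
  pose w y := n.+1%:R^-1 *: z + y.
  have wL y : ~ L y -> L (w y).
    move=> nLy m _.
    have [N yN] : exists N, forall k, (N <= k)%N -> ~ B k y.
      apply: contrapT => /forallNP h; apply: nLy => N _.
      by have /existsNP[k /not_implyP[Nk /contrapT Bk]] := h N; exists k.
      (* k >= 2 (n + 1), so phi k moves by at least 2 under translation by
       z / (n + 1). *)
    pose k := maxn (maxn m N) (2 * n.+1); exists k.
      by rewrite /= /k (leq_trans (leq_maxl m N))// leq_maxl.
    have /yN : (N <= k)%N by rewrite /k (leq_trans (leq_maxr m N))// leq_maxl.
    rewrite /B /w /= dualD// dualZ// => /negP; rewrite -ltNge => yk.
    have [_ -> _] := phiP k.
    have : 2 <= n.+1%:R^-1 * k%:R :> R.
      by rewrite ler_pdivlMl// -natrM ler_nat mulnC leq_maxr.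
    move: (_ * k%:R) => u u2.
    rewrite ler_normr; apply/orP; left.
    by move: yk; rewrite ltr_norml => /andP[? ?]; lra.
  have mw : measurable_fun [set: borel_type E] (fun y : borel_type E => \1_(~` L) (w y) : R).
    rewrite /w; under eq_fun do rewrite addrC.
    apply: (measurable_translate _ (f := \1_(~` L) : E -> R)).
    by apply: measurable_indic; exact: measurableC.
  have ind01 (A : set (borel_type E)) y : `|\1_A y : R| <= 1.
    by rewrite indicE; case: (_ \in _); rewrite ?normr1 ?normr0.
  apply/eqP; rewrite eq_le; apply/andP; split; last first.
    by apply: Rintegral_ge0 => y _; rewrite indicE.
  have -> : 0 = \int[mu]_y (\1_L y : R).
    by apply: EFin_inj; rewrite indic_Rintegral// L0.
  apply: le_Rintegral => //.
  - by apply: (prob_bounded_integrable mu mw) => y; exact: ind01.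
  - apply: (@prob_bounded_integrable _ _ _ mu _ 1) => [|y]; last exact: ind01.
    exact: measurable_indic.
  move=> y _; rewrite !indicE in_setC.
  have [Ly|nLy] := pselect (L y); first by rewrite (mem_set Ly) lern1 leq_b1.
  by rewrite (mem_set (wL _ nLy)).
have := tc _ (measurableC mL); rewrite I1.
under eq_fun do rewrite I0.
move=> c1; have h : (0 : R) = 1.
  by apply: (cvg_unique (@Rhausdorff R) _ c1); exact: cvg_cst.
by have := oner_eq0 R; rewrite -h eqxx.
Qed.

(** Uniform boundedness for the functionals phi o T with phi of variance at most
    1. *)
Lemma cameron_martin_uniform (T : {linear E -> E}) : continuous T ->
  (forall x, exists C, forall phi, dual phi ->
    `|phi (T x)| <= C * Num.sqrt (cov mu phi phi)) ->
  exists2 C, 0 <= C & forall x, cameron_martin_le mu (T x) (C * `|x|).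
Proof.
move=> cT Tb.
pose F := [set f : E -> R^o | exists phi, [/\ dual phi, cov mu phi phi <= 1 & f = phi \o T]].
have [||C C0 FC] := @uniform_boundedness R E R^o F.
- move=> _ [phi [dphi _ ->]]; have [lphi [C phiC]] := dual_comp dphi cT.
  by split => //; exists C.
- move=> x; have [C TC] := Tb x; exists `|C| => _ [phi [dphi v1 ->]] /=.
  rewrite (le_trans (TC phi dphi))// (le_trans (ler_wpM2r (sqrtr_ge0 _) (ler_norm C)))//.
  by rewrite ler_piMr// -sqrtr1 ler_wsqrtr.
exists C => // x phi dphi.
have [s0|s0] := eqVneq (Num.sqrt (cov mu phi phi)) 0.
  by have [D] := Tb x; move=> /(_ phi dphi); rewrite s0 !mulr0.
have {}s0 : 0 < Num.sqrt (cov mu phi phi) by rewrite lt_def s0 sqrtr_ge0.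
set s := Num.sqrt _ in s0 *.
have := FC (fun x => s^-1 * phi (T x)) _ x.
rewrite normrM normfV (gtr0_norm s0) ler_pdivrMl// mulrC; apply.
exists (fun x => s^-1 * phi x); split => //; first exact: dual_scale.
have cs : cov mu phi phi = s ^+ 2 by rewrite /s sqr_sqrtr// cov_ge0.
by rewrite cov_scale// cs exprVn mulVf// expf_neq0// gt_eqF.
Qed.

End gaussian_dichotomy.

(** * The Ornstein-Uhlenbeck semigroup *)

Section ornstein_uhlenbeck.
Context {R : realType} {E H : completeNormedModType R}.
Variables (ip : {dot H for idfun}) (hip : induces_norm ip).
Variables (i : {linear H -> E}) (hi_cont : continuous i).
Variables (S : R -> {linear E -> E}) (hS : C0_semigroup S).
Hypothesis hE : separable E.
Implicit Types phi : E -> R.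

Local Notation g phi s := (istar ip i (phi \o S s)).
Local Notation leb := (@lebesgue_measure R).

(** The variance of phi is the energy of the path s |-> istar (phi o S s). *)
Lemma cov_energy (t : R) (m : probability (borel_type E) R) phi :
  is_covariance_operator (Qt ip i S t) m -> dual phi ->
  cov m phi phi = \int[leb]_(s in `[0, t]) ip (g phi s) (g phi s).
Proof.
move=> hm dphi; rewrite -(dual_Qt hip hi_cont hS hE t dphi dphi).
by have [f cf fphi] := dual_linear dphi; rewrite -fphi hm.
Qed.

Let Rintegral_cst_itv (u c : R) : 0 <= u ->
  \int[leb]_(s in `[0, u]) cst c s = c * u.
Proof.
move=> u0; have lebu : leb `[0, u]%classic = u%:E.
  rewrite lebesgue_measure_itv/= lte_fin; case: ltP => [_|u0'].
    by rewrite oppr0 adde0.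
  by congr EFin; apply/eqP; rewrite eq_le u0 u0'.
rewrite Rintegral_cst//; congr (_ * _).
exact: (congr1 fine lebu).
Qed.

Section restricted.
Variables (SH : R -> {linear H -> H}) (hSH : C0_semigroup SH).
Hypothesis iSH : forall t h, 0 <= t -> i (SH t h) = S t (i h).

(** As S s o i = i o SH s, the vector istar (phi o S s) is the image of istar phi
    under the adjoint of SH s, whose norm is bounded on [0, t]. *)
Lemma energy_le (t : R) : 0 <= t -> exists2 C, 0 <= C & forall phi, dual phi ->
  \int[leb]_(s in `[0, t]) ip (g phi s) (g phi s) <= (C * `|istar ip i phi|) ^+ 2.
Proof.
move=> t0; have [C C0 SC] := C0_locally_bounded hSH t.
exists (Num.sqrt t * C) => [|phi dphi]; first by rewrite mulr_ge0// sqrtr_ge0.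
pose K := C * `|istar ip i phi|.
have K0 : 0 <= K by rewrite mulr_ge0.
have gK s : 0 <= s -> s <= t -> `|g phi s| <= K.
  move=> s0 st; apply: norm_istar_le => //; first exact: dual_semigroup.
  move=> h; rewrite /= -iSH// -(istarP hip hi_cont dphi).
  rewrite (le_trans (ip_cauchy_schwarz hip _ _))// /K (mulrC C) -mulrA.
  by rewrite ler_wpM2l// SC.
have finm : (leb `[0%R, t] < +oo)%E.
  by rewrite lebesgue_measure_itv/=; case: ifP => _; rewrite ?ltry.
have mI : measurable (`[0, t]%classic : set (measurableTypeR R)) by [].
have ic : leb.-integrable `[0, t] (EFin \o cst (K ^+ 2)).
  by apply: (bounded_integrable mI finm (M := `|K ^+ 2|)).
apply: (@le_trans _ _ (\int[leb]_(s in `[0, t]) cst (K ^+ 2) s)).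
  apply: le_Rintegral => //; first exact: integrable_ip_istar.
  move=> s; rewrite /= in_itv/= => /andP[s0 st].
  by rewrite hip; apply: lerXn2r; rewrite ?nnegrE ?normr_ge0// gK.
have -> : Num.sqrt t * C * `|istar ip i phi| = Num.sqrt t * K by rewrite mulrA.
by rewrite Rintegral_cst_itv// (exprMn 2 (Num.sqrt t) K) sqr_sqrtr// mulrC.
Qed.

(** By energy_le the bound is in terms of |istar phi|, so the Riesz theorem
    provides h in H with phi z = <h, istar phi> = phi (i h) for all phi. *)
Lemma range_of_bound (t : R) z C : 0 <= t ->
  (forall phi, dual phi -> `|phi z| <=
    C * Num.sqrt (\int[leb]_(s in `[0, t]) ip (g phi s) (g phi s))) ->
  exists h, i h = z.
Proof.
move=> t0 zC; have [D D0 eD] := energy_le t0.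
have [|||||h hP] := @riesz_on_range R H ip hip (E -> R^o) (@dual R E) (istar ip i)
  (fun phi => phi z) (`|C| * D).
- exact: dual_zero.
- by move=> a u v du dv; exact: dual_lincomb.
- by move=> a u v du dv; exact: istar_lincomb.
- by [].
- move=> phi dphi; rewrite (le_trans (zC phi dphi))//.
  rewrite (le_trans (ler_wpM2r (sqrtr_ge0 _) (ler_norm C)))// -mulrA ler_wpM2l//.
  rewrite -[leRHS]ger0_norm ?mulr_ge0// -sqrtr_sqr ler_wsqrtr//.
  exact: eD.
exists h; apply/subr0_eq; apply: dual_separates => phi dphi.
by rewrite dualB// -(istarP hip hi_cont dphi) ipC (hP _ dphi) subrr.
Qed.

(** For s <= r = t / 2 one has S t x = S s (i (SH (r - s) k)), hence
    phi (S t x) is the inner product of istar (phi o S s) and SH (r - s) k. Square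
    and integrate over [0, r]. *)
Lemma bound_of_range (t : R) x k : 0 < t -> S (t / 2) x = i k ->
  exists C, forall phi, dual phi -> `|phi (S t x)| <=
    C * Num.sqrt (\int[leb]_(s in `[0, t]) ip (g phi s) (g phi s)).
Proof.
move=> t0 xk; pose r := t / 2.
have r0 : 0 < r by rewrite divr_gt0.
have [C C0 SC] := C0_locally_bounded hSH r.
pose K := C * `|k|; have K0 : 0 <= K by rewrite mulr_ge0.
exists (Num.sqrt r^-1 * K) => phi dphi.
have phiS s : 0 <= s -> s <= r -> phi (S t x) ^+ 2 <= K ^+ 2 * ip (g phi s) (g phi s).
  move=> s0 sr; have rs0 : 0 <= r - s by rewrite subr_ge0.
  have -> : phi (S t x) = ip (g phi s) (SH (r - s) k).
    rewrite (istarP hip hi_cont); last exact: dual_semigroup.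
    have r0' := ltW r0; rewrite /= iSH// -xk -!(C0_add hS)//; last exact: addr_ge0.
    by congr (phi (S _ x)); rewrite /r; lra.
  rewrite hip -exprMn -[leLHS]real_normK ?num_real//.
  apply: lerXn2r; rewrite ?nnegrE ?mulr_ge0//.
  rewrite (le_trans (ip_cauchy_schwarz hip _ _))// mulrC ler_wpM2r//.
  by rewrite (le_trans (SC _ rs0 _ _))// lerBlDr lerDl.
have mI u : measurable (`[0, u]%classic : set (measurableTypeR R)) by [].
have finm u : (leb `[0%R, u] < +oo)%E.
  by rewrite lebesgue_measure_itv/=; case: ifP => _; rewrite ?ltry.
have ii u := integrable_ip_istar hip hi_cont hS u dphi dphi.
have h1 : r * phi (S t x) ^+ 2 <=
    K ^+ 2 * \int[leb]_(s in `[0, r]) ip (g phi s) (g phi s).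
  rewrite -(RintegralZl _ (mI r) (ii r)).
  have -> : r * phi (S t x) ^+ 2 = \int[leb]_(s in `[0, r]) cst (phi (S t x) ^+ 2) s.
    by rewrite Rintegral_cst_itv ?(ltW r0)// mulrC.
  apply: le_Rintegral => //.
  - by apply: (bounded_integrable (mI r) (finm r) (M := `|phi (S t x) ^+ 2|)).
  - exact: (integrableZl (mI r) (K ^+ 2) (ii r)).
  - by move=> s; rewrite /= in_itv/= => /andP[s0 sr]; exact: phiS.
have h2 : \int[leb]_(s in `[0, r]) ip (g phi s) (g phi s) <=
    \int[leb]_(s in `[0, t]) ip (g phi s) (g phi s).
  apply: fine_le; [exact: integrable_fin_num (ii r)|exact: integrable_fin_num (ii t)|].
  apply: ge0_subset_integral => //.
  - exact: (measurable_int _ (ii t)).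
  - by move=> s _; rewrite lee_fin hip sqr_ge0.
  - by apply: subset_itvl; rewrite bnd_simp /r; lra.
set I := \int[leb]_(s in `[0, t]) _ in h2 *.
have h3 : phi (S t x) ^+ 2 <= r^-1 * K ^+ 2 * I.
  rewrite -mulrA ler_pdivlMl// (le_trans h1)//.
  by rewrite ler_wpM2l// sqr_ge0.
have := ler_wsqrtr h3; rewrite sqrtr_sqr => /le_trans; apply.
rewrite sqrtrM ?mulr_ge0 ?invr_ge0 ?sqr_ge0 ?(ltW r0)//.
by rewrite sqrtrM ?invr_ge0 ?(ltW r0)// sqrtr_sqr ger0_norm.
Qed.

End restricted.

End ornstein_uhlenbeck.

Theorem theorem6p8 (R : realType) (E H : completeNormedModType R)
    (ip : {dot H for idfun}) (hip : induces_norm ip)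
    (i : {linear H -> E}) (hi_cont : continuous i) (hi_inj : injective i)
    (S : R -> {linear E -> E}) (hS : C0_semigroup S)
    (mu : R -> probability (borel_type E) R)
    (hE : separable E)
    (hmu0 : forall A : set (borel_type E), measurable A ->
      mu 0 A = \d_((0 : E) : borel_type E) A)
    (hmu : forall t : R, 0 < t ->
      centred_gaussian (mu t) /\ is_covariance_operator (Qt ip i S t) (mu t))
    (hSH : restricts_to_C0_semigroup i S) :
  strong_feller (ornstein_uhlenbeck S mu) <->
  (forall t : R, 0 < t -> range (S t) `<=` range i).
Proof.
have [SH [hSH' iSH]] := hSH.
split=> [feller t t0 z [x _ <-]|rangeS t t0 f mf /pinfty_ex_gt0[M M0 fM]].
  have [gt ct] := hmu t t0.
  have [C zC] : exists C, forall phi, dual phi ->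
      `|phi (S t x)| <= C * Num.sqrt (cov (mu t) phi phi).
    apply: (cameron_martin_of_continuity gt) => A mA.
    have [|cA _] := feller t t0 (\1_A : E -> R) (measurable_indic mA).
      exists 1; split => // r r1 y _ /=; rewrite indicE.
      by rewrite (le_trans _ (ltW r1))//; case: (_ \in _); rewrite ?normr1 ?normr0.
    have x0 : n.+1%:R^-1 *: x @[n --> \oo] --> (0 : E).
      by rewrite -(scale0r x); apply: cvgZl; exact: cvg_harmonic.
    have : ornstein_uhlenbeck S mu t (\1_A : E -> R) (n.+1%:R^-1 *: x) @[n --> \oo] -->
        ornstein_uhlenbeck S mu t (\1_A : E -> R) 0.
      by apply: continuous_cvg => //; exact: cA.
    rewrite /ornstein_uhlenbeck linear0.
    under [X in _ --> X -> _]eq_Rintegral do rewrite add0r.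
    by under eq_fun do rewrite linearZ/=.
  have [|h <-] := @range_of_bound _ _ _ ip hip i hi_cont S hS SH hSH' iSH t (S t x) C (ltW t0).
    by move=> phi dphi; rewrite -(cov_energy hip hi_cont hS hE ct)// zC.
  by exists h.
have [gt ct] := hmu t t0.
have [C C0 Cb] : exists2 C, 0 <= C & forall x, cameron_martin_le (mu t) (S t x) (C * `|x|).
  apply: (cameron_martin_uniform gt); first exact: C0_bounded hS t (ltW t0).
  move=> x; have [k _ kx] := rangeS (t / 2) (divr_gt0 t0 (ltr0Sn _ _)) _ (ex_intro2 _ _ x Logic.I erefl).
  have [D DP] := bound_of_range hip hi_cont hS hSH' iSH t0 (esym kx).
  exists D => phi dphi.
  by rewrite (cov_energy hip hi_cont hS hE ct)// DP.
have mfx x : measurable_fun [set: borel_type E] ((fun y => f (S t x + y)) : borel_type E -> R).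
  have := measurable_translate (S t x) mf.
  by under eq_fun do rewrite addrC.
split.
  move=> x; apply/cvgrPdist_le => e e0.
  have lip x' : `|ornstein_uhlenbeck S mu t f x' - ornstein_uhlenbeck S mu t f x| <=
      2 * M * (C * `|x' - x|).
    have := gaussian_shift gt hE (mulr_ge0 C0 (normr_ge0 (x' - x))) (Cb (x' - x)) (mfx x) M0
      (fun y => fM (S t x + y) Logic.I).
    rewrite /ornstein_uhlenbeck; congr (`|_ - _| <= _).
    by apply: eq_Rintegral => y _; congr f; rewrite linearB addrC -addrA subrK addrC.
  have K0 : 0 < 2 * M * C + 1 by rewrite ltr_wpDl// mulr_ge0// mulr_ge0// ltW.
  near=> x'; rewrite distrC (le_trans (lip x'))//.
  rewrite mulrA (@le_trans _ _ ((2 * M * C + 1) * `|x' - x|))//.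
    by rewrite ler_wpM2r// lerDl.
  rewrite -ler_pdivlMl// distrC; near: x'.
  by apply: cvgr_dist_le => //; rewrite mulr_gt0// invr_gt0.
exists M; split; [exact: num_real|move=> r Mr x _ /=].
have ifx : (mu t).-integrable [set: borel_type E] (EFin \o (fun y => f (S t x + y))).
  by apply: (@prob_bounded_integrable _ _ _ (mu t) _ M) => // y; exact: fM.
rewrite (le_trans _ (ltW Mr))// (le_trans (le_normr_Rintegral measurableT ifx))//.
apply: (@le_trans _ _ (\int[mu t]_y cst M y)); last by rewrite (prob_Rintegral_cst (mu t)).
apply: le_Rintegral => //; first exact: integrable_norm.
- by apply: (@prob_bounded_integrable _ _ _ (mu t) _ `|M|).
- by move=> y _; exact: fM.
Unshelve. all: by end_near. Qed.
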